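(* Let $s,t\in\mathbb N$ be relatively prime, let $\sigma$ be an $s$-core and $\tau$ a $t$-core, and for $k\in\mathbb N$ let $$N_{\sigma,\tau}(k)=\#\{\lambda\in\mathcal C_{st}\ :\ \mathrm{core}_s\lambda=\sigma,\ \mathrm{core}_t\lambda=\tau,\ \ell(\lambda)\le k\}.$$ Then there is a quasipolynomial $Q_{\sigma,\tau}(k)$ of degree $(s-1)(t-1)$ and period $st$ such that $N_{\sigma,\tau}(k)=Q_{\sigma,\tau}(k)$ for all sufficiently large integers $k$. The leading coefficient of $Q_{\sigma,\tau}$ is a positive number $V_{s,t}$ depending only on $s$ and $t$, namely the relative volume of the transportation polytope of real $t\times s$ matrices with nonnegative entries, all row sums equal to $s$ and all column sums equal to $t$.
   Context: A partition $\lambda=(a_1,\dots,a_\ell)$ is a weakly decreasing finite sequence of positive integers; $\ell(\lambda)=\ell$ is its length (the empty partition has length $0$). For $t\in\mathbb N$, a $t$-core is a partition whose Young diagram contains no hook of size (hooklength) $t$; $\mathcal C_t$ denotes the set of $t$-cores. For a partition $\lambda$, $\mathrm{core}_t\lambda$ is the $t$-core of $\lambda$: the partition obtained by successively removing rim hooks (border strips) of size $t$ from the Young diagram of $\lambda$ until none remain (the result is independent of the choices). A function $Q:\mathbb N\to\mathbb Q$ is a quasipolynomial of period $p\in\mathbb N$ if for each $0\le i<p$ the function $n\mapsto Q(i+np)$ ($n=0,1,2,\dots$) is a polynomial $P_i(n)$; its degree is the maximum of the degrees of the $P_i$. ''The leading coefficient of $Q$ is $c$'' means that each $P_i$ (for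 the stated period) has degree equal to the degree of $Q$ and leading coefficient $c$. Relative volume: if $\mathcal P\subset\mathbb R^n$ is a polytope with integer vertices and dimension $d$ (dimension of its affine span), choose an affine isomorphism $T$ from the affine span of $\mathcal P$ onto $\mathbb R^d$ mapping the integer points of the affine span bijectively onto $\mathbb Z^d$; the relative volume of $\mathcal P$ is the ($d$-dimensional) volume of $T(\mathcal P)$, which is independent of $T$. *)

(* Defs.v *)
From mathcomp Require Import all_boot all_order all_algebra.
From mathcomp Require Import reals.
Set Implicit Arguments. Unset Strict Implicit. Unset Printing Implicit Defensive.
Import Order.TTheory GRing.Theory Num.Theory.

Definition is_partition (lam : seq nat) : bool :=
  sorted geq lam && all (fun a => 0 < a) lam.

Definition plength (lam : seq nat) : nat := size lam.

(* hook length of the cell (i,j) (row i, column j, 0-indexed) of lam,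
   meaningful for i < size lam and j < lam_i:
   arm = lam_i - j - 1, leg = #{k > i : lam_k > j}, hook = arm + leg + 1 *)
Definition hook_length (lam : seq nat) (i j : nat) : nat :=
  (nth 0 lam i - j.+1) + count (fun a => j < a) (drop i.+1 lam) + 1.

Definition is_tcore (t : nat) (lam : seq nat) : Prop :=
  forall i j, i < size lam -> j < nth 0 lam i -> hook_length lam i j <> t.

(* mu is obtained from lam by removing a rim hook (border strip) of size t:
   mu is a partition contained in lam, |lam| = |mu| + t, and the skew shape
   lam/mu (cells (i,j) with mu_i <= j < lam_i) is a connected skew shape
   containing no 2x2 square: its nonempty rows are exactly the consecutive
   rows r..r', and consecutive rows i, i+1 overlap in exactly one column
   (lam_(i+1) = mu_i + 1). *)
Definition remove_rim_hook (t : nat) (lam mu : seq nat) : Prop :=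
  is_partition mu /\
  sumn lam = sumn mu + t /\
  exists r r', r <= r' /\
    (forall i, (i < r) || (r' < i) -> nth 0 mu i = nth 0 lam i) /\
    (forall i, r <= i <= r' -> nth 0 mu i < nth 0 lam i) /\
    (forall i, r <= i < r' -> nth 0 lam i.+1 = (nth 0 mu i).+1).

Inductive rim_reduces (t : nat) : seq nat -> seq nat -> Prop :=
| rim_refl lam : rim_reduces t lam lam
| rim_step lam mu nu :
    remove_rim_hook t lam mu -> rim_reduces t mu nu -> rim_reduces t lam nu.

(* core_t lam = sig : sig is reached from lam by successively removing rim
   hooks of size t until none remain (the result is independent of the
   choices, so this relational reading is the function core_t) *)
Definition is_core_of (t : nat) (lam sig : seq nat) : Prop :=
  rim_reduces t lam sig /\ forall mu, ~ remove_rim_hook t sig mu.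

Definition quasipoly_period_deg_lead (Q : nat -> rat) (p d : nat) (c : rat)
  : Prop :=
  exists P : nat -> {poly rat},
    forall i, i < p ->
      (forall n, Q (i + n * p) = ((P i).[n%:R])%R) /\
      size (P i) = d.+1 /\ (lead_coef (P i) = c)%R.

Local Open Scope ring_scope.

Definition is_int_val {R : realType} (x : R) : Prop := exists z : int, x = z%:~R.

Definition int_mx {R : realType} {m n : nat} (X : 'M[R]_(m, n)) : Prop :=
  forall i j, is_int_val (X i j).

Definition aff_span {R : realType} {m n : nat} (P : 'M[R]_(m, n) -> Prop)
  (X : 'M[R]_(m, n)) : Prop :=
  exists (k : nat) (p : 'I_k -> 'M[R]_(m, n)) (w : 'I_k -> R),
    (forall i, P (p i)) /\ \sum_i w i = 1 /\ X = \sum_i w i *: p i.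

Definition lattice_affine_iso {R : realType} {m n : nat}
  (P : 'M[R]_(m, n) -> Prop) (d : nat) (T : 'M[R]_(m, n) -> 'rV[R]_d) : Prop :=
  (forall (k : nat) (p : 'I_k -> 'M[R]_(m, n)) (w : 'I_k -> R),
      (forall i, aff_span P (p i)) -> \sum_i w i = 1 ->
      T (\sum_i w i *: p i) = \sum_i w i *: T (p i)) /\
  (forall X Y, aff_span P X -> aff_span P Y -> T X = T Y -> X = Y) /\
  (forall y, exists2 X, aff_span P X & T X = y) /\
  (forall X, aff_span P X -> (int_mx X <-> int_mx (T X))).

Definition scaled_lattice_points {R : realType} {d : nat}
  (S : 'rV[R]_d -> Prop) (n : nat) (l : seq 'rV[int]_d) : Prop :=
  uniq l /\
  forall z : 'rV[int]_d, z \in l <-> S ((n%:R)^-1 *: map_mx (fun a : int => a%:~R) z).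

(* d-dimensional volume of S ⊂ R^d equals v (Jordan/Riemann volume):
   #(S ∩ (1/n)Z^d) / n^d --> v as n --> oo *)
Definition volume_is {R : realType} {d : nat} (S : 'rV[R]_d -> Prop) (v : R)
  : Prop :=
  forall eps : R, 0 < eps -> exists N : nat, forall n : nat, (N <= n)%N ->
    exists l, scaled_lattice_points S n.+1 l /\
      `| (size l)%:R / (n.+1)%:R ^+ d - v | < eps.

Definition relative_volume_is {R : realType} {m n : nat}
  (P : 'M[R]_(m, n) -> Prop) (v : R) : Prop :=
  exists (d : nat) (T : 'M[R]_(m, n) -> 'rV[R]_d),
    lattice_affine_iso P T /\ volume_is (fun y => exists2 X, P X & T X = y) v.

Definition transport_polytope (R : realType) (s t : nat) (X : 'M[R]_(t, s))
  : Prop :=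
  (forall i j, 0 <= X i j) /\
  (forall i, \sum_j X i j = s%:R) /\
  (forall j, \sum_i X i j = t%:R).
Arguments transport_polytope R s t X : clear implicits.

(* Main.v *)
Require Import Defs.
From mathcomp Require Import all_boot all_order all_algebra.
From mathcomp Require Import reals.
From mathcomp Require Import boolp.
From mathcomp Require Import zify ring lra.
Import Order.TTheory GRing.Theory Num.Theory.
Set Implicit Arguments. Unset Strict Implicit. Unset Printing Implicit Defensive.

(** With k beads on the abacus, a partition of length at most k is the set of
    positions x_i = lambda_i + (k - 1 - i); removing a rim hook of size m moves a
    bead down by m, so an m-core is a bead set closed under subtracting m, and it
    is determined by its number of beads in each class modulo m.  By the Chinese
    remainder theorem an st-core is then a t x s matrix of naturals, whose column
    and row sums are prescribed by its s-core and its t-core.  Replacing k by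
    k + st adds s to each row sum and t to each column sum, so on each class of k
    modulo st one counts the lattice points of a transportation polytope with
    margins b_i + n s, c_j + n t.

    Polynomiality in n: Gale's feasibility theorem shows that for large n such a
    matrix contains an integral matrix with margins s, t, so that all matrices
    arise from finitely many by adding integral points of the undeformed polytope;
    choosing lexicographically least presentations reduces the count to Hilbert
    functions of down-sets of N^L, which are eventually polynomial by Dickson's
    lemma.  Translation by fixed matrices sandwiches the count between values of
    the Ehrhart function of the undeformed polytope, which fixes the degree and the
    leading coefficient, and the points of (1/n) Z^d in the projected polytope are
    counted by the Ehrhart function at n. *)

(** * Growth and summation of polynomials *)

Section PolynomialGrowth.
Local Open Scope ring_scope.

(** The constant is the sum of the absolute values of the lower coefficients, since
    [n ^ i * n <= n ^ d] for [i < d]. The factor [n] on the left replaces an error term of order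
    1/n. *)
Lemma horner_nat_asymptotic (R : realFieldType) (P : {poly R}) (d : nat) :
  (size P <= d.+1)%N ->
  exists A : R, forall n : nat, (0 < n)%N ->
    `|P.[n%:R] - P`_d * n%:R ^+ d| * n%:R <= A * n%:R ^+ d.
Proof.
move=> szP; exists (\sum_(i < d) `|P`_i|) => n n0.
have n1 : 1 <= n%:R :> R by rewrite ler1n.
rewrite (horner_coef_wide _ szP) big_ord_recr /= addrK.
apply: (@le_trans _ _ ((\sum_(i < d) `|P`_i| * n%:R ^+ i) * n%:R)).
  rewrite ler_wpM2r ?ler0n //; apply: le_trans (ler_norm_sum _ _ _) _.
  by apply: ler_sum => i _; rewrite normrM normrX (ger0_norm (ler0n _ _)).
rewrite !mulr_suml; apply: ler_sum => i _.
rewrite -mulrA -exprSr ler_wpM2l //; exact: ler_weXn2l.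
Qed.

(** With a negative leading coefficient c, the asymptotic estimate would force [n <= A / (- c)] for
    all large n. *)
Lemma lead_coef_ge0 (P : {poly rat}) (N : nat) :
  (forall n, (N <= n)%N -> 0 <= P.[n%:R]) -> 0 <= lead_coef P.
Proof.
move=> P0; have [->|Pn0] := eqVneq P 0; first by rewrite lead_coef0.
rewrite leNgt; apply/negP => cneg.
have [A HA] := @horner_nat_asymptotic _ P (size P).-1 (leqSpred _).
have [n nlt] : exists n : nat, A / (- lead_coef P) < n%:R.
  exists (Num.bound `|A / (- lead_coef P)|).
  by apply: le_lt_trans (ler_norm _) _; apply: archi_boundP.
pose m := (maxn N n).+1.
have m0 : 0 < (m%:R : rat) by rewrite ltr0n.
have := HA m isT; have := P0 m (leq_trans (leq_maxl N n) (leqnSn _)).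
rewrite -/(lead_coef P); set v := P.[_]; set e := m%:R ^+ _ => v0 le1.
have e0 : 0 < e by rewrite exprn_gt0.
have le2 : (- lead_coef P) * e * m%:R <= A * e.
  apply: le_trans le1; rewrite ler_wpM2r ?ler0n //.
  by apply: le_trans (ler_norm _); rewrite mulNr lerDr.
move: le2; rewrite mulrAC ler_pM2r // leNgt => /negP; apply.
rewrite mulrC -ltr_pdivrMr ?oppr_gt0 //; apply: lt_le_trans nlt _.
by rewrite ler_nat leqW // leq_maxr.
Qed.

(** Both claims come from the sign lemma applied to [P] and [Q - P]: wherever [P] wins at the top
    degree, it makes the leading coefficient of [Q - P] negative. *)
Lemma poly_le_growth (P Q : {poly rat}) (N : nat) :
    (forall n, (N <= n)%N -> 0 <= P.[n%:R] <= Q.[n%:R]) ->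
  (size P <= size Q)%N /\ (size P = size Q -> lead_coef P <= lead_coef Q).
Proof.
move=> PQ.
have lP : 0 <= lead_coef P by apply: (@lead_coef_ge0 _ N) => n /PQ /andP[].
have lD : 0 <= lead_coef (Q - P).
  by apply: (@lead_coef_ge0 _ N) => n /PQ /andP[_]; rewrite hornerD hornerN subr_ge0.
have szle : (size P <= size Q)%N.
  rewrite leqNgt; apply/negP => szlt; move: lD.
  rewrite addrC lead_coefDl ?size_polyN // lead_coefN oppr_ge0 => lP'.
  have /eqP : lead_coef P = 0 by apply/eqP; rewrite eq_le lP lP'.
  by rewrite lead_coef_eq0 => /eqP P0; rewrite P0 size_poly0 in szlt.
split=> // szE; rewrite leNgt; apply/negP => lt.
have QP : (Q - P)`_(size P).-1 < 0 by rewrite coefB {1}szE subr_lt0.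
suff szD : (size (Q - P)%R).-1 = (size P).-1 by move: lD; rewrite lead_coefE szD leNgt QP.
apply/eqP; rewrite eqn_leq; apply/andP; split.
  have: (size (Q - P)%R <= size P)%N.
    by apply: leq_trans (size_polyD _ _) _; rewrite size_polyN -szE maxnn.
  move=> ?; lia.
rewrite leqNgt; apply/negP => ltsz; move: QP; rewrite nth_default ?ltxx //.
exact: leq_trans (leqSpred _) ltsz.
Qed.

Lemma size_comp_linear (P : {poly rat}) (a b : rat) :
  a != 0 -> size (P \Po (a *: 'X + b%:P)) = size P.
Proof.
move=> a0; apply: size_comp_poly2.
by rewrite size_polyDl ?size_scale ?size_polyX // size_polyC; case: (b == 0).
Qed.

Lemma lead_coef_comp_shift (P : {poly rat}) (b : rat) :
  lead_coef (P \Po ('X + b%:P)) = lead_coef P.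
Proof.
have sz : size ('X + b%:P : {poly rat}) = 2.
  by rewrite size_polyDl size_polyX // size_polyC; case: (b == 0).
rewrite lead_coef_comp ?sz // lead_coefDl ?lead_coefX ?expr1n ?mulr1 //.
by rewrite size_polyX size_polyC; case: (b == 0).
Qed.

Definition eventually_poly (f : nat -> nat) :=
  exists (P : {poly rat}) (N : nat), forall n, (N <= n)%N -> (f n)%:R = P.[n%:R].

Lemma eventually_poly_eq (f g : nat -> nat) (N : nat) :
  (forall n, (N <= n)%N -> f n = g n) -> eventually_poly f -> eventually_poly g.
Proof.
move=> fg [P [M PM]]; exists P, (maxn M N) => n; rewrite geq_max => /andP[nM nN].
by rewrite -fg // PM.
Qed.

Lemma eventually_polyD (f g : nat -> nat) :
  eventually_poly f -> eventually_poly g -> eventually_poly (fun n => f n + g n)%N.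
Proof.
move=> [P [M PM]] [Q [N QN]]; exists (P + Q), (maxn M N) => n.
by rewrite geq_max => /andP[nM nN]; rewrite natrD hornerD PM ?QN.
Qed.

Lemma eventually_poly_sum (g : nat -> nat -> nat) (m : nat) :
  (forall j, (j < m)%N -> eventually_poly (g j)) ->
  eventually_poly (fun n => \sum_(j < m) g j n)%N.
Proof.
elim: m => [|m IH] H.
  by exists 0, 0%N => n _; rewrite big_ord0 horner0.
apply: (@eventually_poly_eq (fun n => \sum_(j < m) g j n + g m n)%N _ 0).
  by move=> n _; rewrite big_ord_recr.
by apply: eventually_polyD; [apply: IH => j jm; apply: H; rewrite ltnS ltnW|apply: H].
Qed.

Lemma eventually_poly_shift (f : nat -> nat) (j : nat) :
  eventually_poly f -> eventually_poly (fun n => f (n - j)%N).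
Proof.
move=> [P [N PN]]; exists (P \Po ('X - j%:R%:P)), (N + j)%N => n nN.
have jn : (j <= n)%N by apply: leq_trans nN; rewrite leq_addl.
rewrite horner_comp !hornerE -natrB // PN //.
by rewrite leq_subRL // addnC.
Qed.

(** Induction on the size: [c] is chosen so that the difference of [c *: 'X^d.+1] has the same top
    term as [P], which leaves a remainder of smaller size. *)
Lemma poly_antidifference (P : {poly rat}) :
  exists S : {poly rat}, forall n : nat, S.[n.+1%:R] - S.[n%:R] = P.[n%:R].
Proof.
have [m] := ubnP (size P); elim: m P => // m IH P; rewrite ltnS => szP.
have [->|P0] := eqVneq P 0; first by exists 0 => n; rewrite !horner0 subrr.
pose d := (size P).-1.
have dE : size P = d.+1 by rewrite prednK // size_poly_gt0.
pose c := lead_coef P / d.+1%:R.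
pose E : {poly rat} := c *: (('X + 1) ^+ d.+1 - 'X^(d.+1)).
have EE : E = \sum_(i < d.+1) (c *+ 'C(d.+1, i)) *: 'X^i.
  rewrite /E ['X + 1]addrC exprDn big_ord_recr /= subnn expr0 mul1r binn mulr1n addrK.
  rewrite scaler_sumr; apply: eq_bigr => i _.
  by rewrite expr1n mul1r -scalerMnr scalerMnl.
have szE : (size E <= d.+1)%N.
  rewrite EE; apply: leq_trans (size_sum _ _ _) _; apply/bigmax_leqP => i _.
  by apply: leq_trans (size_scale_leq _ _) _; rewrite size_polyXn.
have Ed : E`_d = lead_coef P.
  rewrite EE coef_sum (bigD1 (Ordinal (ltnSn d))) //= big1.
    rewrite coefZ coefXn eqxx mulr1 addr0 binSn -mulr_natr /c divfK //.
    by rewrite pnatr_eq0.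
  move=> i ne; rewrite coefZ coefXn; case: eqP => [e|]; rewrite ?mulr0 //.
  by case/eqP: ne; apply: val_inj.
have [|S HS] := IH (P - E).
  apply: leq_trans szP; rewrite dE ltnS; apply/leq_sizeP => j dj.
  rewrite coefB; move: dj; rewrite leq_eqVlt => /predU1P[<-|dj].
    by rewrite Ed lead_coefE dE subrr.
  by rewrite !nth_default ?subrr ?dE //; apply: leq_trans dj.
exists (S + c *: 'X^(d.+1)) => n.
have -> : P = (P - E) + E by rewrite subrK.
rewrite [RHS]hornerD -HS /E !hornerE -natr1; ring.
Qed.

Lemma eventually_poly_partial_sums (f : nat -> nat) :
  eventually_poly f -> eventually_poly (fun n => \sum_(i < n.+1) f i)%N.
Proof.
move=> [P [N PN]]; have [S HS] := poly_antidifference P.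
(* The sum telescopes only from [N] on; the constant term accounts for the values of [f] before
   [N]. *)
exists (S \Po ('X + 1%:P) + ((\sum_(i < N) f i)%N%:R - S.[N%:R])%:P), N => n nN.
rewrite hornerD horner_comp hornerC hornerD hornerX hornerC natr1.
have key m : (N <= m)%N ->
  (\sum_(i < m) f i)%N%:R = S.[m%:R] + ((\sum_(i < N) f i)%N%:R - S.[N%:R]).
  elim: m => [|m IH]; first by rewrite leqn0 => /eqP->; ring.
  rewrite leq_eqVlt => /predU1P[<-|Nm]; first by ring.
  rewrite big_ord_recr /= natrD IH // PN // -HS; ring.
by apply: key; apply: leqW.
Qed.

End PolynomialGrowth.

(** * Hilbert functions of down-sets *)

Section DownSets.

Definition down_closed (L : nat) (D : seq nat -> bool) :=
  forall u v, size v = L -> all2 leq u v -> D v -> D u.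

Lemma all2_leq_refl (u : seq nat) : all2 leq u u.
Proof. by elim: u => //= a u ->; rewrite leqnn. Qed.

Lemma down_closed_cons (L : nat) (D : seq nat -> bool) (j : nat) :
  down_closed L.+1 D -> down_closed L (fun u => D (j :: u)).
Proof. by move=> DD u v sv uv; apply: DD; rewrite /= ?sv ?leqnn. Qed.

Lemma down_closed_consS (L : nat) (D : seq nat -> bool) (i j : nat) (u : seq nat) :
  down_closed L.+1 D -> i <= j -> size u = L -> D (j :: u) -> D (i :: u).
Proof. by move=> DD ij su; apply: DD; rewrite /= ?su ?ij ?all2_leq_refl. Qed.

(* Dickson's lemma; the induction step compares the sections [C j (a :: _)]
   with the diagonal chain [C j (j :: _)]. *)
Lemma down_closed_chain_stable (L : nat) (C : nat -> seq nat -> bool) :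
    (forall j, down_closed L (C j)) ->
    (forall i j u, i <= j -> size u = L -> C j u -> C i u) ->
  exists J, forall j u, J <= j -> size u = L -> C j u = C J u.
Proof.
elim: L C => [|L IH] C CD Cdec.
  have [all|/existsNP[J /negP CJ]] := pselect (forall j, C j [::]).
    by exists 0 => j u _ /size0nil->; rewrite !all.
  exists J => j u Jj /size0nil->; rewrite (negbTE CJ).
  by apply/negP => /(Cdec _ _ [::] Jj erefl); apply/negP.
have [J HJ] := IH (fun j u => C j (j ::
  u)) (fun j => down_closed_cons (CD j)) (fun i j u ij su Cj =>
  down_closed_consS (CD i) ij su (Cdec _ _ (j :: u) ij (congr1 S su) Cj)).
(* The diagonal bound [J] handles all first coordinates [a >= J] at once; each of the finitely many
   [a < J] gets its own bound [F a]. *)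
have /choice[F HF] a : exists J', forall j u, J' <= j -> size u = L -> C j (a :: u) = C J' (a :: u).
  apply: (IH (fun j u => C j (a :: u))) => [j|i j u ij su]; first exact: down_closed_cons.
  by apply: Cdec; rewrite //= su.
exists (maxn J (\max_(a < J) F a)) => j [|a u] //; rewrite geq_max => /andP[Jj Fj] [su].
have [aJ|Ja] := ltnP a J.
  have FM : F a <= \max_(a < J) F a by apply: (leq_bigmax (Ordinal aJ)).
  by rewrite (HF a) ?(leq_trans FM) // [RHS](HF a) // leq_max FM orbT.
(* With [m = maxn a i], [C i (a :: u)] lies between [C m (m :: u)] and [C J (J :: u)], which agree
   because the diagonal chain is stable beyond [J]. *)
have key i : J <= i -> C i (a :: u) = C J (J :: u).
  move=> Ji; pose m := maxn a i.
  have Jm : J <= m by rewrite leq_max Ja.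
  apply/idP/idP => [Ci|CJ].
    by apply: (Cdec _ _ _ Ji); rewrite /= ?su //; apply: down_closed_consS Ci.
  apply: (Cdec i m); rewrite /= ?su ?leq_maxr //.
  by apply: (down_closed_consS (CD m) (leq_maxl a i : a <= m) su); rewrite HJ.
by rewrite !key // leq_maxl.
Qed.

Fixpoint compositions (L n : nat) : seq (seq nat) :=
  if L is L'.+1
  then flatten [seq map (cons j) (compositions L' (n - j)) | j <- iota 0 n.+1]
  else if n == 0 then [:: [::]] else [::].

Lemma mem_compositions (L n : nat) (u : seq nat) :
  (u \in compositions L n) = (size u == L) && (sumn u == n).
Proof.
elim: L n u => [|L IH] n u; first by case: u n => [|a u] [|n].
rewrite [compositions _ _]/compositions -/compositions.
case: u => [|a u]; first by apply/negbTE/negP => /flatten_mapP[j _ /mapP[]].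
apply/flatten_mapP/andP => [[j]|[/eqP[su] /eqP sn]].
  rewrite mem_iota => /andP[_ jn] /mapP[v]; rewrite IH => /andP[/eqP sv /eqP nv] [-> ->].
  by rewrite /= sv nv eqxx subnKC.
exists a; first by rewrite mem_iota /= -sn ltnS leq_addr.
by apply/map_f; rewrite IH su -sn addKn !eqxx.
Qed.

Lemma uniq_compositions (L n : nat) : uniq (compositions L n).
Proof.
elim: L n => [|L IH] n; first by case: n.
rewrite [compositions _ _]/compositions -/compositions.
apply: (allpairs_uniq_dep (f := fun j u => j :: u)) => [|//|]; first exact: iota_uniq.
by move=> [i u] [j v] /= _ _ [-> ->].
Qed.

(** For a down-set [D], read as the monomials outside a monomial ideal in [L] variables, this is the
    Hilbert function of the quotient. *)
Definition hilbert (L : nat) (D : seq nat -> bool) (n : nat) : nat :=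
  count D (compositions L n).

Lemma hilbertS (L : nat) (D : seq nat -> bool) (n : nat) :
  hilbert L.+1 D n = \sum_(j < n.+1) hilbert L (fun u => D (nat_of_ord j :: u)) (n - j).
Proof.
rewrite /hilbert [compositions _ _]/compositions -/compositions.
rewrite count_flatten -map_comp sumnE big_map -[iota 0 n.+1]/(index_iota 0 n.+1).
by rewrite big_mkord; apply: eq_bigr => j _; rewrite /= count_map.
Qed.

(** Slice by the first exponent j. The slices form a decreasing chain that is constant from some [J]
    on, so the count is a finite sum of shifted Hilbert functions plus partial sums of the stable
    one. *)
Lemma eventually_poly_hilbert (L : nat) (D : seq nat -> bool) :
  down_closed L D -> eventually_poly (hilbert L D).
Proof.
elim: L D => [|L IH] D DD.
  by exists 0%R, 1 => -[|n] // _; rewrite horner0.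
have [J HJ] := @down_closed_chain_stable L (fun j u => D (j :: u))
  (fun j => down_closed_cons DD) (fun i j u ij su => down_closed_consS DD ij su).
pose g j := hilbert L (fun u => D (j :: u)).
have gP j : eventually_poly (g j) by apply/IH/down_closed_cons.
have gJ j : J <= j -> g j =1 g J.
  move=> Jj n; apply: eq_in_count => u; rewrite mem_compositions => /andP[/eqP su _].
  exact: HJ.
have := eventually_polyD (eventually_poly_sum (fun j _ => eventually_poly_shift j (gP j)) (m := J))
  (eventually_poly_shift J (eventually_poly_partial_sums (gP J))).
apply: (@eventually_poly_eq _ _ J) => n Jn.
rewrite hilbertS -[RHS](big_mkord xpredT (fun j => g j (n - j))).
rewrite [RHS](@big_cat_nat _ _ _ J) ?leqW //= big_mkord; congr (_ + _).
rewrite -[J in RHS]add0n big_addn big_mkord subSn // [RHS](reindex_inj rev_ord_inj) /=.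
apply: eq_bigr => i _; rewrite gJ ?leq_addl //; congr g.
by have := ltn_ord i; lia.
Qed.

End DownSets.

(** * Counting elements generated by finitely many translations *)

Section GeneratedSets.

Variable V : nmodType.
Local Open Scope ring_scope.

Fixpoint lincomb (ps : seq V) (u : seq nat) : V :=
  match ps, u with p :: ps', a :: u' => p *+ a + lincomb ps' u' | _, _ => 0 end.

Fixpoint lex_lt (u v : seq nat) : bool :=
  match u, v with
  | a :: u', b :: v' => (a < b)%N || (a == b) && lex_lt u' v'
  | _, _ => false
  end.

Fixpoint add_seq (u v : seq nat) : seq nat :=
  match u, v with a :: u', b :: v' => (a + b)%N :: add_seq u' v' | _, _ => [::] end.

Lemma size_add_seq (u v : seq nat) : size u = size v -> size (add_seq u v) = size v.
Proof. by elim: u v => [|a u IH] [|b v] //= [/IH->]. Qed.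

Lemma all2_leq_add_seq (u v : seq nat) :
  all2 leq u v -> exists2 w, size w = size u & v = add_seq u w.
Proof.
elim: u v => [|a u IH] [|b v] //=; first by exists [::].
by case/andP => ab /IH[w sw ->]; exists ((b - a)%N :: w); rewrite /= ?sw // subnKC.
Qed.

Lemma lincomb_add_seq (ps : seq V) (u v : seq nat) :
    size u = size ps -> size v = size ps ->
  lincomb ps (add_seq u v) = lincomb ps u + lincomb ps v.
Proof.
elim: ps u v => [|p ps IH] [|a u] [|b v] //=; rewrite ?addr0 // => -[su] [sv].
by rewrite IH // mulrnDr addrACA.
Qed.

Lemma lex_lt_add_seq (u v w : seq nat) :
    size u = size w -> size v = size w ->
  lex_lt (add_seq u w) (add_seq v w) = lex_lt u v.
Proof.
elim: w u v => [|c w IH] [|a u] [|b v] //= [su] [sv].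
by rewrite IH // ltn_add2r eqn_add2r.
Qed.

Lemma lex_lt_total (u v : seq nat) :
  size u = size v -> ~~ lex_lt u v -> ~~ lex_lt v u -> u = v.
Proof.
elim: u v => [|a u IH] [|b v] //= [suv].
by case: ltngtP => //= -> /IH H /H ->.
Qed.

(** At a fixed length the order is well-founded: minimise the first entry, then recurse on the tails
    available under that entry. *)
Lemma lex_lt_min (L : nat) (P : seq nat -> Prop) :
    (exists2 u, size u = L & P u) ->
  exists u, [/\ size u = L, P u & forall v, size v = L -> P v -> ~~ lex_lt v u].
Proof.
elim: L P => [|L IH] P [u su Pu].
  by exists u; split=> // v /size0nil->.
case: u => // a u in su Pu *; case: su => su.
have exa : exists a, `[< exists2 u, size u = L & P (a :: u) >] by exists a; apply/asboolP; exists u.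
case: (ex_minnP exa) => {exa su Pu u}a /asboolP exu amin.
have [v [sv Pv vmin]] := IH (fun u => P (a :: u)) exu.
exists (a :: v); split=> /= [||[|b w] //= [sw] Pw]; rewrite ?sv //.
have ab : (a <= b)%N by apply: amin; apply/asboolP; exists w.
rewrite negb_or -leqNgt ab /=; apply/nandP; case: eqP => [e|]; [right|by left].
by apply: vmin => //; rewrite -e.
Qed.

(* Each element is represented by its lexicographically least presentation
   [g_k + lincomb ps u]; for fixed k the exponents of these form a down-set. *)
Lemma eventually_poly_generated (ps G : seq V) (f : nat -> seq V) :
    (forall n, uniq (f n)) ->
    (forall n x, x \in f n <-> exists g u,
       [/\ g \in G, size u = size ps, sumn u = n & x = g + lincomb ps u]) ->
    (forall g h u v, g \in G -> h \in G -> size u = size ps -> size v = size ps ->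
       g + lincomb ps u = h + lincomb ps v -> sumn u = sumn v) ->
  eventually_poly (fun n => size (f n)).
Proof.
move=> funiq fP grade; pose L := size ps.
pose val k u := nth 0 G k + lincomb ps u.
pose D k u := `[< forall k' u', (k' < size G)%N -> size u' = L ->
  val k' u' = val k u -> ~~ lex_lt (k' :: u') (k :: u) >].
have DD k : down_closed L (D k).
  move=> u v sv uv /asboolP Dv; apply/asboolP => k' u' k'G su' e.
  have su : size u = L by rewrite -sv; move: uv; rewrite all2E => /andP[/eqP].
  (* A smaller presentation of [val k u] becomes, after adding [w] to its exponents, a smaller
     presentation of [val k v], because the order is translation invariant. *)
  have [w sw vE] := all2_leq_add_seq uv.
  have := Dv k' (add_seq u' w) k'G; rewrite vE /= !lex_lt_add_seq ?sw ?su ?su' //; apply.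
    by rewrite size_add_seq ?sw ?su.
  by rewrite /val !lincomb_add_seq ?sw ?su // !addrA -/(val _ _) e.
pose r n := [seq val k u | k <- iota 0 (size G), u <- [seq u <- compositions L n | D k u]].
have memr n k u : (u \in [seq u <- compositions L n | D k u]) = [&& D k u, size u == L & sumn u
  == n].
  by rewrite mem_filter mem_compositions.
have runiq n : uniq (r n).
  apply: allpairs_uniq_dep => [|k _|]; first exact: iota_uniq.
    exact/filter_uniq/uniq_compositions.
  move=> [k u] [l v] /allpairsPdep[k1 [u1 [k1G + e1]]] /allpairsPdep[l1 [v1 [l1G + e2]]] /=.
  case: e1 k1G => <- <-; case: e2 l1G => <- <-.
  rewrite !memr !mem_iota !add0n !leq0n /= =>
    lG kG /and3P[/asboolP Dk /eqP su _] /and3P[/asboolP Dl /eqP sv _] e.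
  have [-> -> //] : k :: u = l :: v.
  by apply: lex_lt_total; [rewrite /= su sv|apply: Dl|apply: Dk].
have rf n : r n =i f n.
  move=> x; apply/idP/idP.
    case/allpairsPdep => k [u []];
      rewrite mem_iota memr add0n => /andP[_ kG] /and3P[_ /eqP su /eqP nu] ->.
    by apply/fP; exists (nth 0 G k), u; rewrite mem_nth.
  move/fP => [g [u [gG su nu xE]]].
  (* The generator index is put in front of the exponents, so that one lexicographic minimum selects
     both. *)
  have : exists2 w, size w = L.+1 & (head 0%N w < size G)%N /\ val (head 0%N w) (behead w) = x.
    by exists (index g G :: u); rewrite /= ?su // index_mem gG /val nth_index.
  move/lex_lt_min => [[|k v] [//= [sv] [kG vE] vmin]].
  apply/allpairsPdep; exists k, v; split; rewrite ?mem_iota // memr sv eqxx /=.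
  apply/andP; split.
    by apply/asboolP => k' u' k'G su' e; apply: (vmin (k' :: u')); rewrite /= ?su' ?e.
  (* The least presentation may use another generator; [grade] ensures that its exponents still have
     sum [n]. *)
  by rewrite -nu; apply/eqP; apply: (grade (nth 0 G k) g); rewrite ?mem_nth // -[LHS]/(val k v) vE.
apply: (@eventually_poly_eq (fun n => \sum_(k < size G) hilbert L (D k) n)%N _ 0) => [n _|].
  rewrite -(perm_size (uniq_perm (runiq n) (funiq n) (rf n))) size_allpairs_dep.
  rewrite sumnE big_map -[size G in RHS]subn0 -/(index_iota 0 (size G)) big_mkord.
  by apply: eq_bigr => k _; rewrite size_filter.
apply: (eventually_poly_sum (g := fun k => hilbert L (D k))) => k _.
exact: eventually_poly_hilbert.
Qed.

End GeneratedSets.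

(** * Integral flows *)

Section IntegralFlow.

Variables t s : nat.
Implicit Types (q x p : 'M[nat]_(t, s)) (I : {set 'I_t}) (K : {set 'I_s}).

Definition margins (b c : nat -> nat) (x : 'M[nat]_(t, s)) : bool :=
  [forall i, \sum_j x i j == b i] && [forall j, \sum_i x i j == c j].

Lemma marginsP (b c : nat -> nat) x :
  reflect ((forall i : 'I_t, \sum_j x i j = b i) /\ (forall j : 'I_s, \sum_i x i j = c j))
    (margins b c x).
Proof.
apply: (iffP andP) => -[H1 H2]; split.
- by move=> i; apply/eqP; move/forallP: H1.
- by move=> j; apply/eqP; move/forallP: H2.
- by apply/forallP => i; rewrite H1.
- by apply/forallP => j; rewrite H2.
Qed.

(** In the bipartite network from rows to columns with capacities [q], this is the capacity of the
    edges leaving [I] for columns outside [K]. *)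
Definition cut_value q I K := \sum_i \sum_j q i j * ((i \in I) && (j \notin K)).

Lemma cut_value_submodular q I I' K K' :
  cut_value q (I :&: I') (K :&: K') + cut_value q (I :|: I') (K :|: K')
    <= cut_value q I K + cut_value q I' K'.
Proof.
rewrite /cut_value -!big_split leq_sum // => i _; rewrite -!big_split leq_sum // => j _ /=.
rewrite -!mulnDr leq_mul2l !inE; apply/orP; right.
by case: (i \in I); case: (i \in I'); case: (j \in K); case: (j \in K').
Qed.

Lemma sum_mem_modular (T : finType) (a : T -> nat) (A B : {set T}) :
  \sum_i a i * (i \in A :&: B) + \sum_i a i * (i \in A :|: B) =
  \sum_i a i * (i \in A) + \sum_i a i * (i \in B).
Proof.
rewrite -!big_split; apply: eq_bigr => i _ /=; rewrite -!mulnDr !inE.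
by case: (i \in A); case: (i \in B).
Qed.

Variables a d : nat -> nat.
Hypothesis balanced : \sum_(i < t) a i = \sum_(j < s) d j.

(** The max-flow min-cut inequality: the supply of the rows in [I] must leave through edges avoiding
    [K] or be absorbed by the columns of [K]. *)
Definition cut_condition q := forall I K,
  \sum_(i < t) a i * (i \in I) <= cut_value q I K + \sum_(j < s) d j * (j \in K).

Definition tight q I K :=
  \sum_(i < t) a i * (i \in I) = cut_value q I K + \sum_(j < s) d j * (j \in K).

(** Uncrossing: the cut value is submodular and the demands are modular, so equality at two cuts
    forces equality at their meet and join. *)
Lemma tight_setI q I I' K K' :
  cut_condition q -> tight q I K -> tight q I' K' -> tight q (I :&: I') (K :&: K').
Proof.
rewrite /tight => cc e e'.
have := cc (I :&: I') (K :&: K'); have := cc (I :|: I') (K :|: K').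
have := cut_value_submodular q I I' K K'.
have := sum_mem_modular (fun i : 'I_t => a i) I I'.
have := sum_mem_modular (fun j : 'I_s => d j) K K'.
move: e e' => /= -> ->.
set k1 := \sum_(i < s) _; set k2 := \sum_(i < s) _; set k3 := \sum_(i < s) _;
  set k4 := \sum_(i < s) _.
set i1 := \sum_(i < t) _; set i2 := \sum_(i < t) _.
move: k1 k2 k3 k4 i1 i2 (cut_value _ _ _) (cut_value _ _ _) (cut_value _ _ _) (cut_value _ _ _)
  => *.
lia.
Qed.

Lemma tight_setT q : tight q setT setT.
Proof.
rewrite /tight [cut_value _ _ _]big1 ?add0n.
  rewrite (eq_bigr (fun i : 'I_t => a i)) => [|i _]; last by rewrite inE muln1.
  by rewrite balanced; apply: eq_bigr => j _; rewrite inE muln1.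
by move=> i _; rewrite big1 // => j _; rewrite !inE muln0.
Qed.

Lemma cut_value_setD1 q I K (i : 'I_t) :
  i \in I -> cut_value q I K = \sum_j q i j * (j \notin K) + cut_value q (I :\ i) K.
Proof.
move=> iI; rewrite /cut_value (bigD1 i) //= iI; congr (_ + _).
rewrite [RHS](bigD1 i) //= [X in _ = X + _]big1 ?add0n; last by move=> j _; rewrite !inE eqxx muln0.
by apply: eq_bigr => i' ne; apply: eq_bigr => j _; rewrite !inE ne.
Qed.

Lemma sum_mem_setD1 (T : finType) (w : T -> nat) (A : {set T}) (i : T) :
  i \in A -> \sum_k w k * (k \in A) = w i + \sum_k w k * (k \in A :\ i).
Proof.
move=> iA; rewrite (bigD1 i) //= iA muln1 [in RHS](bigD1 i) //= !inE eqxx muln0 add0n.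
by congr (_ + _); apply: eq_bigr => k ne; rewrite !inE ne.
Qed.

Lemma cut_condition_row q (i : 'I_t) : cut_condition q -> a i <= \sum_j q i j.
Proof.
move=> /(_ [set i] set0).
rewrite (cut_value_setD1 _ _ (set11 i)) setDv {1}(bigD1 i) //= inE eqxx muln1.
rewrite [X in _ + X]big1 ?addn0 => [|i' ne]; last by rewrite inE (negbTE ne) muln0.
rewrite [cut_value _ _ _]big1 => [|i' _]; last by rewrite big1 // => j _; rewrite inE muln0.
rewrite [X in _ + X]big1 ?addn0 => [|j _]; last by rewrite inE muln0.
by under eq_bigr do rewrite inE muln1.
Qed.

(* If each positive entry lies in a tight cut, the intersection of the tight
   cuts through the entries of a row forces that row sum to equal its demand. *)
Lemma minimal_row_sum q (i : 'I_t) :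
    cut_condition q ->
    (forall j, 0 < q i j -> exists I K, [/\ tight q I K, i \in I & j \notin K]) ->
  \sum_j q i j = a i.
Proof.
move=> cc H.
have [I [K [tK iI KP]]] : exists I K, [/\ tight q I K, i \in I &
    forall j, j \in enum 'I_s -> 0 < q i j -> j \notin K].
  elim: (enum 'I_s) => [|j js [I [K [tK iI KP]]]].
    by exists setT, setT; rewrite inE; split=> //; apply: tight_setT.
  have [q0|q0] := posnP (q i j).
    by exists I, K; split=> // j'; rewrite inE => /predU1P[->|/KP//]; rewrite q0.
  have [I' [K' [tK' iI' jK']]] := H j q0.
  exists (I :&: I'), (K :&: K'); split; first exact: tight_setI.
    by rewrite inE iI.
  move=> j'; rewrite !inE negb_and => /predU1P[->|j's qj]; first by rewrite jK' orbT.
  by rewrite KP.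
apply/eqP; rewrite eqn_leq cut_condition_row // andbT.
(* Every positive entry of row [i] lies outside [K], so removing [i] from the tight cut lowers its
   value by the full row sum and its demand by [a i]. The cut condition for the rest then bounds the
   row sum by [a i]. *)
have := cc (I :\ i) K; move: tK;
  rewrite /tight (cut_value_setD1 _ _ iI) (sum_mem_setD1 (fun i : 'I_t => a i) iI).
have -> : \sum_j q i j * (j \notin K) = \sum_j q i j.
  apply: eq_bigr => j _; have [->//|q0] := posnP (q i j).
  by rewrite KP ?mem_enum ?muln1.
move=> /=; set A := \sum_(i < t) _; set D := \sum_(j < s) d j * _; set X := \sum_j _.
move: A D X (cut_value _ _ _) => A D X Y; lia.
Qed.

(* Gale's feasibility theorem: lower entries while the cut condition survives;
   a minimal matrix then has exactly the required margins. *)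
Lemma exists_flow q :
  cut_condition q -> exists2 p : 'M[nat]_(t, s), (forall i j, p i j <= q i j) & margins a d p.
Proof.
have [m] := ubnP (\sum_i \sum_j q i j); elim: m q => // m IH q; rewrite ltnS => qm cc.
have [[i [j [q0 cc']]]|noD] := pselect (exists i j, 0 < q i j /\
    cut_condition (\matrix_(i' < t, j' < s) (q i' j' - ((i' == i) && (j' == j)))%N)%R).
  set q' := (\matrix_(_ < t, _ < s) _)%R in cc'.
  have q'E i' j' : q i' j' = q' i' j' + ((i' == i) && (j' == j)).
    by rewrite mxE subnK //; do 2!case: eqP => [->|//].
  have [|p pq' pm] := IH q' _ cc'.
    apply: leq_trans qm; rewrite (bigD1 i) //= (bigD1 j) //= [X in _ < X](bigD1 i) //= [X in _ <
      X + _](bigD1 j) //=.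
    rewrite [q i j]q'E !eqxx addn1 !addSn ltnS leq_add // ?leq_add //.
      by apply: leq_sum => j' _; rewrite [q _ _]q'E leq_addr.
    by apply: leq_sum => i' _; apply: leq_sum => j' _; rewrite [q _ _]q'E leq_addr.
  by exists p => // i' j'; rewrite q'E (leq_trans (pq' _ _)) // leq_addr.
exists q => //; apply/marginsP.
have rows i : \sum_j q i j = a i.
  (* If lowering entry (i, j) by one violates a cut, that cut was tight before and separates row [i]
     from column [j]. *)
  apply: minimal_row_sum => // j q0; apply: contrapT => nt; apply: noD.
  exists i, j; split=> // I K; rewrite leqNgt; apply/negP => lt.
  apply: nt; exists I, K.
  set q' := (\matrix_(_ < t, _ < s) _)%R in lt.
  have cutE : cut_value q I K = cut_value q' I K + ((i \in I) && (j \notin K)).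
    have -> : ((i \in I) && (j \notin K) : nat) =
        \sum_i' \sum_j' ((i' == i) && (j' == j)) * ((i' \in I) && (j' \notin K)).
      rewrite (bigD1 i) //= (bigD1 j) //= !eqxx mul1n.
      rewrite big1 => [|j' /negbTE->]; last by rewrite andbF.
      by rewrite addn0 big1 ?addn0 // => i' /negbTE->; rewrite big1.
    rewrite -big_split; apply: eq_bigr => i' _; rewrite -big_split; apply: eq_bigr => j' _ /=.
    by rewrite -mulnDl mxE subnK //; do 2!case: eqP => [->|//].
  have := cc I K; move: lt; rewrite /tight cutE.
  case: (boolP (i \in I)) => iI; case: (boolP (j \in K)) => jK /=; split=> //; lia.
split=> // j.
have tot : \sum_(j < s) \sum_i q i j = \sum_(j < s) d j.
  by rewrite exchange_big /= -balanced; apply: eq_bigr => i _.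
(* The cut with all rows and all columns but [j'] shows that each column sum is at least its demand;
   equal totals then make every one of these inequalities an equality. *)
have col (j' : 'I_s) : d j' <= \sum_i q i j'.
  have := cc setT (setT :\ j'); rewrite {1}/cut_value.
  have -> : \sum_(i < t) a i * (i \in setT) = \sum_(j < s) d j.
    by rewrite -balanced; apply: eq_bigr => i _; rewrite inE muln1.
  have -> : \sum_(j < s) d j = d j' + \sum_(j < s) d j * (j \in setT :\ j').
    rewrite -(sum_mem_setD1 (fun j : 'I_s => d j)) ?inE //.
    by apply: eq_bigr => j0 _; rewrite inE muln1.
  rewrite leq_add2r; congr (_ <= _); apply: eq_bigr => i _.
  rewrite (bigD1 j') //= !inE eqxx muln1 big1 ?addn0 // => j0 ne.
  by rewrite !inE ne muln0.
have := leqif_sum (fun (j : 'I_s) (_ : xpredT j) => leqif_eq (col j)).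
move=> [_]; rewrite tot eqxx => /esym /forallP /(_ j) /eqP //.
Qed.

End IntegralFlow.

(** * Matrices with prescribed margins *)

Section TransportCount.

Variables t s : nat.
Implicit Types (x p : 'M[nat]_(t, s)) (b c : nat -> nat).

(** No entry exceeds the total [B] of the row sums, so enumerating matrices over the finite type
    ['I_B.+1] misses none. *)
Definition margin_mxs b c : seq 'M[nat]_(t, s) :=
  let B := \sum_(i < t) b i in
  [seq x <- [seq map_mx (@nat_of_ord B.+1) y | y <- enum {: 'M['I_B.+1]_(t, s)}] | margins b c x].

Lemma margin_mxs_uniq b c : uniq (margin_mxs b c).
Proof.
apply/filter_uniq; rewrite map_inj_uniq ?enum_uniq // => y z /matrixP e.
by apply/matrixP => i j; have := e i j; rewrite !mxE => /val_inj.
Qed.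

Lemma mem_margin_mxs b c x : (x \in margin_mxs b c) = margins b c x.
Proof.
rewrite mem_filter andb_idr // => /marginsP[rx _].
have xB i j : x i j < (\sum_(i < t) b i).+1.
  by rewrite ltnS (bigD1 i) //= -rx (bigD1 j) //= -addnA leq_addr.
apply/mapP; exists (\matrix_(i < t, j < s) Ordinal (xB i j))%R; first by rewrite mem_enum.
by apply/matrixP => i j; rewrite !mxE.
Qed.

Definition scaled_margins b c (n : nat) x : bool :=
  margins (fun i => b i + n * s) (fun j => c j + n * t) x.

Definition transport_count b c (n : nat) : nat :=
  size (margin_mxs (fun i => b i + n * s) (fun j => c j + n * t)).

Lemma mx_natD x p i j : (x + p)%R i j = x i j + p i j.
Proof. by rewrite mxE. Qed.

Lemma marginsD b c b' c' x p :
  margins b c x -> margins b' c' p -> margins (fun i => b i + b' i) (fun j => c j + c' j) (x + p)%R.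
Proof.
move=> /marginsP[rx cx] /marginsP[rp cp]; apply/marginsP; split=> [i|j].
  by rewrite -rx -rp -big_split; apply: eq_bigr => j _; rewrite mx_natD.
by rewrite -cx -cp -big_split; apply: eq_bigr => i _; rewrite mx_natD.
Qed.

Lemma eq_margins b c b' c' x : b =1 b' -> c =1 c' -> margins b c x = margins b' c' x.
Proof.
by move=> eb ec; congr (_ && _); apply: eq_forallb => i; rewrite ?eb ?ec.
Qed.

Lemma margins0 : margins (fun=> 0) (fun=> 0) (0%R : 'M[nat]_(t, s)).
Proof. by apply/marginsP; split=> i; rewrite big1 // => j _; rewrite mxE. Qed.

Lemma marginsB b c b' c' x p :
    (forall i j, p i j <= x i j) -> margins b c x -> margins b' c' p ->
  margins (fun i => b i - b' i) (fun j => c j - c' j) (\matrix_(i < t, j < s) (x i j - p i j)%N)%R.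
Proof.
move=> px /marginsP[rx cx] /marginsP[rp cp]; apply/marginsP; split=> [i|j].
  by rewrite -rx -rp -sumnB //; apply: eq_bigr => j _; rewrite mxE.
by rewrite -cx -cp -sumnB //; apply: eq_bigr => i _; rewrite mxE.
Qed.

(** Gale's condition with capacities [x]: the margins of [x] give
    [n * (s * #|I| - t * #|K|) <= cut + C], where [C] is the sum of the [c j]. When the bracket is
    positive and [n > C], the cut is at least the bracket, as required. *)
Lemma scaled_margins_contain_point b c (n : nat) x :
    scaled_margins b c n x -> \sum_(j < s) c j < n ->
  exists2 p : 'M[nat]_(t, s), (forall i j, p i j <= x i j) & margins (fun=> s) (fun=> t) p.
Proof.
move=> /marginsP[rx cx] nC; apply: exists_flow.
  by rewrite !sum_nat_const !card_ord mulnC.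
move=> I K.
have e1 : \sum_(i < t) s * (i \in I) = s * #|I|.
  rewrite -big_distrr /=; congr (_ * _); rewrite -sum1_card [RHS]big_mkcond.
  by apply: eq_bigr => i _; case: ifP.
have e2 : \sum_(j < s) t * (j \in K) = t * #|K|.
  rewrite -big_distrr /=; congr (_ * _); rewrite -sum1_card [RHS]big_mkcond.
  by apply: eq_bigr => i _; case: ifP.
rewrite e1 e2.
have le1 : n * (s * #|I|) <= cut_value x I K + (\sum_(j < s) c j + n * (t * #|K|)).
  apply: (@leq_trans (\sum_(i < t) (b i + n * s) * (i \in I))).
    rewrite -e1 big_distrr; apply: leq_sum => i _ /=.
    by rewrite mulnA leq_mul2r leq_addl orbT.
  apply: (@leq_trans (cut_value x I K + \sum_(j < s) (c j + n * t) * (j \in K))); last first.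
    rewrite leq_add2l -e2 big_distrr -big_split; apply: leq_sum => j _ /=.
    by rewrite mulnDl -mulnA leq_add2r; case: (j \in K); rewrite ?muln1 ?muln0.
  have -> : \sum_(i < t) (b i + n * s) * (i \in I) = \sum_i \sum_j x i j * (i \in I).
    by apply: eq_bigr => i _; rewrite -rx big_distrl.
  have -> : \sum_(j < s) (c j + n * t) * (j \in K) = \sum_i \sum_j x i j * (j \in K).
    by rewrite exchange_big; apply: eq_bigr => j _; rewrite -cx big_distrl.
  rewrite /cut_value -big_split; apply: leq_sum => i _; rewrite -big_split.
  apply: leq_sum => j _ /=; rewrite -mulnDr leq_mul2l; apply/orP; right.
  by case: (i \in I); case: (j \in K).
have [le|lt] := leqP (s * #|I|) (t * #|K|); first exact: leq_trans le (leq_addl _ _).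
move: le1 lt nC; move: (s * _) (t * _) (cut_value _ _ _) (\sum_(j < s) _) => A B X C.
move=> le1 lt nC; have [e eE] : exists e, A = B + e.+1 by exists (A - B.+1); lia.
have [m mE] : exists m, n = m.+1 + C by exists (n - C.+1); lia.
by move: le1; rewrite eE mE; nia.
Qed.

Hypothesis s_gt0 : 0 < s.
Hypothesis t_gt0 : 0 < t.

Let ps := margin_mxs (fun=> s) (fun=> t).

Lemma mulrn_nat (a n : nat) : (a *+ n)%R = a * n.
Proof. by elim: n => [|n IH]; rewrite ?mulr0n ?muln0 // mulrSr IH mulnSr. Qed.

Lemma lincomb_margins (u : seq nat) : size u = size ps ->
  margins (fun=> sumn u * s) (fun=> sumn u * t) (lincomb ps u).
Proof.
have : all (margins (fun=> s) (fun=> t)) ps by apply/allP => p; rewrite mem_margin_mxs.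
elim: ps u => [|p qs IH] [|a u] //= => [_ _|/andP[pm /IH H] [/H um]]; first exact: margins0.
have pam : margins (fun=> a * s) (fun=> a * t) (p *+ a)%R.
  have /marginsP[rp cp] := pm; apply/marginsP; split=> [i|j].
    by rewrite -[X in _ = _ * X](rp i) mulnC big_distrl; apply: eq_bigr => j _;
      rewrite mulmxnE mulrn_nat.
  by rewrite -[X in _ = _ * X](cp j) mulnC big_distrl; apply: eq_bigr => i _;
    rewrite mulmxnE mulrn_nat.
by rewrite -(eq_margins _ (fun i => esym (mulnDl a _ s)) (fun j => esym (mulnDl a _ t))) marginsD.
Qed.

(** Above scale [C] an integral point of the undeformed polytope can be split off repeatedly. The
    matrices at scale [m + C] are thus those at scale [C] plus sums of [m] such points. *)
Lemma eventually_poly_transport_count b c : eventually_poly (transport_count b c).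
Proof.
pose C := \sum_(j < s) c j.
pose f m := margin_mxs (fun i => b i + (m + C) * s) (fun j => c j + (m + C) * t).
have fP m x : x \in f m = scaled_margins b c (m + C) x by rewrite mem_margin_mxs.
suff H : eventually_poly (fun m => size (f m)).
  apply: (@eventually_poly_eq _ _ C _ (eventually_poly_shift C H)) => n Cn.
  by rewrite /f subnK.
have scaled_lincomb n u g : scaled_margins b c n g -> size u = size ps ->
    scaled_margins b c (n + sumn u) (g + lincomb ps u)%R.
  move=> gm /lincomb_margins um; have := marginsD gm um.
  by rewrite /scaled_margins; apply: etrans; apply: eq_margins => i; rewrite mulnDl addnA.
apply: (@eventually_poly_generated _ ps (f 0)) => [m|m x|g h u v].
- exact: margin_mxs_uniq.
- rewrite fP; split=> [|[g [u [+ su <- ->]]]]; last first.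
    by rewrite fP => gm; rewrite addnC; apply: scaled_lincomb.
  elim: m x => [|m IH] x xm.
    exists x, (nseq (size ps) 0); rewrite fP size_nseq; split=> //.
      by elim: (size _).
    suff -> : lincomb ps (nseq (size ps) 0) = 0%R by rewrite addr0.
    by elim: ps => //= p qs ->; rewrite mulr0n addr0.
  have [|p px pm] := scaled_margins_contain_point xm; first by rewrite addSn ltnS leq_addl.
  have := marginsB px xm pm.
  set y := (\matrix_(_ < t, _ < s) _)%R => ym.
  have xE : x = (y + p)%R by apply/matrixP => i j; rewrite mx_natD mxE subnK.
  have {}ym : scaled_margins b c (m + C) y.
    move: ym; rewrite /scaled_margins; apply: etrans; apply: eq_margins => i;
      by rewrite addSn mulSn addnCA addKn.
  have [g [u [gG su nu yE]]] := IH _ ym.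
  have pps : p \in ps by rewrite mem_margin_mxs.
  have [e [se ne pE]] : exists e, [/\ size e = size ps, sumn e = 1 & lincomb ps e = p].
    elim: ps pps => //= q qs IHq; rewrite inE => /predU1P[<-|/IHq[e [se ne pE]]].
      exists (1 :: nseq (size qs) 0); rewrite /= size_nseq; split=> //.
        by congr _.+1; elim: (size _).
      suff -> : lincomb qs (nseq (size qs) 0) = 0%R by rewrite addr0.
      by elim: qs {IHq} => //= q' qs ->; rewrite mulr0n addr0.
    by exists (0 :: e); rewrite /= se ne mulr0n add0r.
  exists g, (add_seq u e); split=> //; first by rewrite size_add_seq ?se.
    rewrite -nu -addn1 -ne; move: su; rewrite -se.
    by elim: (u) (e) => [|a u' IHu] [|a' e'] //= [/IHu ->]; rewrite addnACA.
  by rewrite lincomb_add_seq // pE addrA -yE.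
(* The degree is recovered from the sum of the first row, which grows by [s] with each added
   point. *)
move=> gG hG su sv e.
move: gG hG; rewrite !fP =>
  /scaled_lincomb /(_ su) /marginsP[ru _] /scaled_lincomb /(_ sv) /marginsP[rv _].
have := rv (Ordinal t_gt0); rewrite -e ru => /addnI /eqP.
by rewrite eqn_pmul2r // eqn_add2l => /eqP.
Qed.

End TransportCount.

(** * Matrices determined by their margins and a corner block *)

Section CornerBlock.

Variables (V : zmodType) (t s : nat).
Implicit Type X Y : 'M[V]_(t.+1, s.+1).
Local Open Scope ring_scope.

Definition block X : 'M[V]_(t, s) := \matrix_(i, j) X (lift ord0 i) (lift ord0 j).

(** The row sums recover the first column below the corner, and then the column sums recover the
    first row. *)
Lemma block_margins_inj X Y :
    (forall i, \sum_j X i j = \sum_j Y i j) -> (forall j, \sum_i X i j = \sum_i Y i j) ->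
  block X = block Y -> X = Y.
Proof.
move=> eqr eqc /matrixP eqb.
have eqS i j : X (lift ord0 i) (lift ord0 j) = Y (lift ord0 i) (lift ord0 j).
  by have := eqb i j; rewrite !mxE.
have eqR i j : X (lift ord0 i) j = Y (lift ord0 i) j.
  case: (unliftP ord0 j) => [j' ->//|->]; have := eqr (lift ord0 i).
  by rewrite !big_ord_recl; under eq_bigr do rewrite eqS; apply: addIr.
apply/matrixP => i j; case: (unliftP ord0 i) => [i' ->//|->]; have := eqc j.
by rewrite !big_ord_recl; under eq_bigr do rewrite eqR; apply: addIr.
Qed.

Definition zero_margin_ext (Y : 'M[V]_(t, s)) : 'M[V]_(t.+1, s.+1) :=
  \matrix_(i, j) match unlift ord0 i, unlift ord0 j with
    | Some i', Some j' => Y i' j'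
    | Some i', None => - \sum_j' Y i' j'
    | None, Some j' => - \sum_i' Y i' j'
    | None, None => \sum_i' \sum_j' Y i' j'
    end.

Lemma zero_margin_ext_row (Y : 'M[V]_(t, s)) i : \sum_j zero_margin_ext Y i j = 0.
Proof.
rewrite big_ord_recl mxE unlift_none; case: (unliftP ord0 i) => [i'|] ->.
  by under [X in _ + X]eq_bigr do rewrite mxE !liftK; rewrite addNr.
under [X in _ + X]eq_bigr do rewrite mxE unlift_none liftK.
by rewrite exchange_big sumrN subrr.
Qed.

Lemma zero_margin_ext_col (Y : 'M[V]_(t, s)) j : \sum_i zero_margin_ext Y i j = 0.
Proof.
rewrite big_ord_recl mxE unlift_none; case: (unliftP ord0 j) => [j'|] ->.
  by under [X in _ + X]eq_bigr do rewrite mxE !liftK; rewrite addNr.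
under [X in _ + X]eq_bigr do rewrite mxE unlift_none liftK.
by rewrite sumrN subrr.
Qed.

End CornerBlock.

(** * Degree and leading coefficient of the transport count *)

Section TransportDegree.

Lemma Posz_sum (I : Type) (r : seq I) (P : pred I) (F : I -> nat) :
  Posz (\sum_(i <- r | P i) F i) = (\sum_(i <- r | P i) Posz (F i))%R.
Proof. exact: (big_morph Posz PoszD erefl). Qed.

Variables t s : nat.
Local Notation mx := 'M[nat]_(t.+1, s.+1).
Implicit Types (b c : nat -> nat) (x y : mx).

Lemma margins_block_inj b c x y :
    margins b c x -> margins b c y ->
    (forall i j, x (lift ord0 i) (lift ord0 j) = y (lift ord0 i) (lift ord0 j)) -> x = y.
Proof.
move=> /marginsP[rx cx] /marginsP[ry cy] e.
suff /matrixP H : map_mx Posz x = map_mx Posz y.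
  by apply/matrixP => i j; have := H i j; rewrite !mxE => -[].
apply: block_margins_inj => [i|j|].
- by under eq_bigr do rewrite mxE; under [RHS]eq_bigr do rewrite mxE; rewrite -!Posz_sum rx ry.
- by under eq_bigr do rewrite mxE; under [RHS]eq_bigr do rewrite mxE; rewrite -!Posz_sum cx cy.
by apply/matrixP => i j; rewrite !mxE e.
Qed.

(** Feasibility with every capacity equal to the total: a single edge leaving the cut already
    carries the whole supply, and without such an edge [I] is empty or [K] is everything. *)
Lemma exists_margins b c :
  \sum_(i < t.+1) b i = \sum_(j < s.+1) c j -> exists x, margins b c x.
Proof.
move=> e; have [|p _ pm] := @exists_flow t.+1 s.+1 b c e (const_mx (\sum_(i < t.+1) b i));
  last by exists p.
move=> I K.
have aI : \sum_(i < t.+1) b i * (i \in I) <= \sum_(i < t.+1) b i.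
  by apply: leq_sum => i _; case: (i \in I); rewrite ?muln1 ?muln0.
have [->|[i iI]] := set_0Vmem I; first by rewrite big1 // => i _; rewrite inE muln0.
have [/setP K0|[j]] := set_0Vmem (~: K).
  apply: leq_trans aI _; rewrite e; apply: leq_trans (leq_addl _ _).
  by apply: leq_sum => j _; have := K0 j; rewrite !inE => /negbFE->; rewrite muln1.
rewrite inE => jK; apply: leq_trans aI _; apply: leq_trans (leq_addr _ _).
by rewrite /cut_value [X in _ <= X](bigD1 i) //= [X in _ <= X + _](bigD1 j) //= iI jK mxE muln1
  -addnA leq_addr.
Qed.

Local Notation count := (@transport_count t.+1 s.+1).
Local Notation ehrhart := (count (fun=> 0) (fun=> 0)).

Lemma transport_count_translate b c b' c' (n n' : nat) y :
    margins (fun i => b' i + n' * s.+1 - (b i + n * s.+1))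
            (fun j => c' j + n' * t.+1 - (c j + n * t.+1)) y ->
    (forall i : 'I_t.+1, b i + n * s.+1 <= b' i + n' * s.+1) ->
    (forall j : 'I_s.+1, c j + n * t.+1 <= c' j + n' * t.+1) ->
  count b c n <= count b' c' n'.
Proof.
move=> ym bb cc; rewrite /transport_count -(size_map (fun x : mx => x + y)%R); apply: uniq_leq_size.
  by rewrite map_inj_uniq ?margin_mxs_uniq // => x x' /matrixP e; apply/matrixP => i j;
    have := e i j; rewrite !mx_natD => /addIn.
move=> _ /mapP[x + ->]; rewrite !mem_margin_mxs => xm.
have /marginsP[r1 c1] := marginsD xm ym; apply/marginsP; split=> [i|j].
  by rewrite r1 subnKC.
by rewrite c1 subnKC.
Qed.

Lemma ehrhart_le_count b c (n : nat) :
  \sum_(i < t.+1) b i = \sum_(j < s.+1) c j -> ehrhart n <= count b c n.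
Proof.
move=> /exists_margins[y ym]; apply: (@transport_count_translate _ _ _ _ _ _ y).
- by rewrite (eq_margins (b' := b) (c' := c)) // => i; rewrite addnK.
- by move=> i; rewrite leq_addl.
- by move=> j; rewrite leq_addl.
Qed.

(** The shift [r] is large enough that [r * s.+1] and [r * t.+1] dominate all [b i] and [c j].
    Adding a fixed matrix with the complementary margins then embeds one set into the other. *)
Lemma count_le_ehrhart b c (n : nat) :
    \sum_(i < t.+1) b i = \sum_(j < s.+1) c j ->
  count b c n <= ehrhart (n + \sum_(i < t.+1) b i).
Proof.
move=> e; set r := \sum_(i < t.+1) b i.
have br (i : 'I_t.+1) : b i <= r * s.+1.
  by apply: leq_trans (leq_pmulr _ _); rewrite // /r (bigD1 i) //= leq_addr.
have cr (j : 'I_s.+1) : c j <= r * t.+1.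
  by apply: leq_trans (leq_pmulr _ _); rewrite // /r e (bigD1 j) //= leq_addr.
have [|y ym] := @exists_margins (fun i => r * s.+1 - b i) (fun j => r * t.+1 - c j).
  by rewrite !sumnB // -e !sum_nat_const !card_ord mulnCA [s.+1 * _]mulnCA [s.+1 * _]mulnC.
apply: (@transport_count_translate _ _ _ _ _ _ y).
- rewrite (eq_margins (b' := fun i => r * s.+1 - b i) (c' := fun j => r * t.+1 - c j)) // => i.
    by rewrite add0n mulnDl [b i + _]addnC subnDl.
  by rewrite add0n mulnDl [c i + _]addnC subnDl.
- by move=> i; rewrite add0n mulnDl addnC leq_add2l.
- by move=> j; rewrite add0n mulnDl addnC leq_add2l.
Qed.

(** The margins leave only the [t * s] entries of the corner block free, and each is at most
    [n * s.+1]. *)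
Lemma ehrhart_upper (n : nat) : ehrhart n <= (n * s.+1).+1 ^ (t * s).
Proof.
pose g (x : mx) : 'M['I_(n * s.+1).+1]_(t, s) :=
  (\matrix_(i < t, j < s) inord (x (lift ord0 i) (lift ord0 j)))%R.
have gle (x : mx) i j :
  x \in margin_mxs _ _ (fun=> 0 + n * s.+1) (fun=> 0 + n * t.+1) -> x i j < (n * s.+1).+1.
  by rewrite mem_margin_mxs => /marginsP[rx _];
    rewrite -[X in _ < X.+1](rx i) ltnS (bigD1 j) //= leq_addr.
rewrite /transport_count -(size_map g); apply: (@leq_trans #|{: 'M['I_(n * s.+1).+1]_(t, s)}|);
  last first.
  by rewrite card_mx card_ord.
rewrite cardE; apply: uniq_leq_size => [|y _]; last by rewrite mem_enum.
rewrite map_inj_in_uniq ?margin_mxs_uniq // => x y xm ym /matrixP e.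
apply: (@margins_block_inj (fun=> 0 + n * s.+1) (fun=> 0 + n * t.+1));
  rewrite -?mem_margin_mxs // => i j.
by have := e i j; rewrite !mxE => /(congr1 val) /=; rewrite !inordK ?gle.
Qed.

(* The all-[n (s + t + 2)] matrix lies deep enough inside the dilated polytope to
   absorb any perturbation of its corner block by entries below [n]. *)
Lemma ehrhart_lower (n : nat) : n ^ (t * s) <= ehrhart (n * (t.+1 + s.+1)).
Proof.
pose N := n * (t.+1 + s.+1).
pose ext (y : 'M['I_n]_(t, s)) := zero_margin_ext (map_mx (fun a : 'I_n => Posz a) y).
pose g (y : 'M['I_n]_(t, s)) : mx := (\matrix_(i < t.+1, j < s.+1) absz (Posz N + ext y i j))%R.
have pos (y : 'M['I_n]_(t, s)) i j : (0 <= Posz N + ext y i j)%R.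
  have y0 i' j' : (0 <= (map_mx (fun a : 'I_n => Posz a) y) i' j')%R by rewrite mxE.
  rewrite mxE; case: (unlift ord0 i) (unlift ord0 j) => [i'|] [j'|].
  - by rewrite addr_ge0.
  - rewrite subr_ge0 (eq_bigr (fun j' => Posz (y i' j'))) => [|j' _]; last by rewrite mxE.
    rewrite -Posz_sum lez_nat; apply: (@leq_trans (\sum_(j' < s) n)).
      by apply: leq_sum => j' _; apply: ltnW.
    by rewrite sum_nat_const card_ord /N; nia.
  - rewrite subr_ge0 (eq_bigr (fun i' => Posz (y i' j'))) => [|i' _]; last by rewrite mxE.
    rewrite -Posz_sum lez_nat; apply: (@leq_trans (\sum_(i' < t) n)).
      by apply: leq_sum => i' _; apply: ltnW.
    by rewrite sum_nat_const card_ord /N; nia.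
  - by rewrite addr_ge0 // sumr_ge0 // => i' _; rewrite sumr_ge0.
have gE (y : 'M['I_n]_(t, s)) i j : Posz (g y i j) = (Posz N + ext y i j)%R by rewrite mxE gez0_abs.
rewrite -[n in n ^ _]card_ord -card_mx cardE -(size_map g); apply: uniq_leq_size.
  rewrite map_inj_uniq ?enum_uniq // => y y' e.
  apply/matrixP => i j; apply: val_inj.
  have := congr1 Posz (congr1 (fun x : mx => x (lift ord0 i) (lift ord0 j)) e).
  by rewrite /= !gE => /addrI; rewrite !mxE !liftK !mxE => -[].
move=> _ /mapP[y _ ->]; rewrite mem_margin_mxs; apply/marginsP; split=> [i|j].
  apply: (can_inj absz_nat : injective Posz); rewrite Posz_sum.
  under eq_bigr do rewrite gE.
  by rewrite big_split /= zero_margin_ext_row addr0 -Posz_sum sum_nat_const card_ord add0n mulnC.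
apply: (can_inj absz_nat : injective Posz); rewrite Posz_sum.
under eq_bigr do rewrite gE.
by rewrite big_split /= zero_margin_ext_col addr0 -Posz_sum sum_nat_const card_ord add0n mulnC.
Qed.

Local Open Scope ring_scope.

(** The two power bounds fix the degree of the Ehrhart polynomial [H]. Any other count lies between
    [H] and a translate of [H], which has the same degree and leading coefficient. As the matrices
    are [t.+1] by [s.+1], the degree [t * s] is the (s-1)(t-1) of the theorem. *)
Lemma transport_count_poly :
  exists H : {poly rat}, [/\ size H = (t * s).+1, 0 < lead_coef H,
    exists N, forall n, (N <= n)%N -> (ehrhart n)%:R = H.[n%:R] &
    forall b c, (\sum_(i < t.+1) b i = \sum_(j < s.+1) c j)%N ->
      exists P : {poly rat}, [/\ size P = (t * s).+1, lead_coef P = lead_coef H &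
        exists N, forall n, (N <= n)%N -> (count b c n)%:R = P.[n%:R]]].
Proof.
have [H [N HN]] := eventually_poly_transport_count (ltn0Sn s) (ltn0Sn t) (fun=> 0%N) (fun=> 0%N).
pose K := (t.+1 + s.+1)%N; pose d := (t * s)%N.
have K0 : K%:R != 0 :> rat by rewrite pnatr_eq0.
have [|lo _] := @poly_le_growth 'X^d (H \Po (K%:R *: 'X + 0%:P)) N.
  move=> n nN; rewrite hornerXn exprn_ge0 ?ler0n //=.
  rewrite horner_comp !hornerE mulrC -natrM -HN ?(leq_trans nN) ?leq_pmulr //.
  by rewrite -natrX ler_nat ehrhart_lower.
have [|up _] := @poly_le_growth H ((s.+1%:R *: 'X + 1%:P) ^+ d) N.
  move=> n nN; rewrite -HN // ler0n /=.
  rewrite horner_exp !hornerE mulrC -natrM natr1 -natrX ler_nat ehrhart_upper //.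
have szH : size H = d.+1.
  apply/eqP; rewrite eqn_leq; apply/andP; split.
    apply: leq_trans up _; apply: leq_trans (size_poly_exp_leq _ _) _.
    rewrite size_polyDl ?size_scale ?size_polyX ?pnatr_eq0 ?mul1n //.
    by rewrite size_polyC oner_eq0.
  by move: lo; rewrite size_comp_linear // size_polyXn.
have lH : 0 < lead_coef H.
  rewrite lt_def lead_coef_eq0 -size_poly_eq0 szH /=.
  by apply: (@lead_coef_ge0 _ N) => n nN; rewrite -HN // ler0n.
exists H; split=> //; first by exists N.
move=> b c e; have [P [M PM]] := eventually_poly_transport_count (ltn0Sn s) (ltn0Sn t) b c.
pose r := (\sum_(i < t.+1) b i)%N.
have [le1 lc1] : (size H <= size P)%N /\ (size H = size P -> lead_coef H <= lead_coef P).
  apply: (@poly_le_growth _ _ (maxn M N)) => n; rewrite geq_max => /andP[nM nN].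
  by rewrite -PM // -HN // ler0n ler_nat ehrhart_le_count.
have szr : size (H \Po ('X + r%:R%:P)) = size H.
  by have := @size_comp_linear H 1 r%:R (oner_neq0 _); rewrite scale1r.
have [le2 lc2] : (size P <= size (H \Po ('X + r%:R%:P)))%N /\
    (size P = size (H \Po ('X + r%:R%:P)) -> lead_coef P <= lead_coef (H \Po ('X + r%:R%:P))).
  apply: (@poly_le_growth _ _ (maxn M N)) => n; rewrite geq_max => /andP[nM nN].
  rewrite -PM // ler0n horner_comp !hornerE -natrD -HN ?(leq_trans nN) ?leq_addr //.
  by rewrite ler_nat count_le_ehrhart.
rewrite szr lead_coef_comp_shift in le2 lc2.
have szPH : size P = size H by apply/eqP; rewrite eqn_leq le1 le2.
exists P; split; [by rewrite szPH|by apply/eqP; rewrite eq_le lc2 // lc1|by exists M].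
Qed.

End TransportDegree.

(** * Relative volume of the transportation polytope *)

Section TransportVolume.

Variables (t s : nat) (R : realType).
Local Open Scope ring_scope.
Local Notation polytope := (transport_polytope R s.+1 t.+1).
Implicit Type X : 'M[R]_(t.+1, s.+1).

(** The polytope without its sign conditions; this is its affine span. *)
Let in_span X := (forall i, \sum_j X i j = s.+1%:R) /\ (forall j, \sum_i X i j = t.+1%:R).

Lemma sum_mx_comb (k : nat) (p : 'I_k -> 'M[R]_(t.+1, s.+1)) (w : 'I_k -> R) i j :
  (\sum_l w l *: p l) i j = \sum_l w l * p l i j.
Proof. by rewrite summxE; apply: eq_bigr => l _; rewrite mxE. Qed.

Lemma affine_in_span (k : nat) (p : 'I_k -> 'M[R]_(t.+1, s.+1)) (w : 'I_k -> R) :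
  (forall l, in_span (p l)) -> \sum_l w l = 1 -> in_span (\sum_l w l *: p l).
Proof.
move=> pP w1; split=> [i|j].
  under eq_bigr do rewrite sum_mx_comb; rewrite exchange_big /=.
  transitivity (\sum_l w l * s.+1%:R); last by rewrite -mulr_suml w1 mul1r.
  by apply: eq_bigr => l _; rewrite -mulr_sumr (pP l).1.
under eq_bigr do rewrite sum_mx_comb; rewrite exchange_big /=.
transitivity (\sum_l w l * t.+1%:R); last by rewrite -mulr_suml w1 mul1r.
by apply: eq_bigr => l _; rewrite -mulr_sumr (pP l).2.
Qed.

(* The all-ones matrix J is an interior point: every X in the span is an affine
   combination of J and of J + e (X - J) for small e > 0. *)
Lemma aff_span_transport X : aff_span polytope X <-> in_span X.
Proof.
split=> [[k [p [w [pP [w1 ->]]]]]|[rX cX]].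
  by apply: affine_in_span => // l; case: (pP l).
(* [A] is 1/e: it bounds every [|X i j - 1|], which keeps [Y] nonnegative, and X = (1 - A) J + A
   Y. *)
pose A := 1 + \sum_i \sum_j `|X i j - 1|.
have A1 : 1 <= A by rewrite lerDl sumr_ge0 // => i _; rewrite sumr_ge0.
have A0 : 0 < A by apply: lt_le_trans A1.
have XA i j : `|X i j - 1| <= A.
  rewrite /A (bigD1 i) //= (bigD1 j) //= addrCA -addrA lerDl.
  by do ![apply: addr_ge0 | apply: sumr_ge0 => ? _ | exact: ler01 | exact: normr_ge0].
pose Y := const_mx 1 + A^-1 *: (X - const_mx 1).
have YE i j : Y i j = 1 + A^-1 * (X i j - 1) by rewrite !mxE.
have sumJr i : \sum_j (const_mx 1 : 'M[R]_(t.+1, s.+1)) i j = s.+1%:R.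
  by under eq_bigr do rewrite mxE; rewrite sumr_const card_ord.
have sumJc j : \sum_i (const_mx 1 : 'M[R]_(t.+1, s.+1)) i j = t.+1%:R.
  by under eq_bigr do rewrite mxE; rewrite sumr_const card_ord.
exists 2, (fun l => if l == ord0 then const_mx 1 else Y), (fun l => if l == ord0 then 1 - A else A).
split=> [l|].
  case: ifP => _; split.
  - by move=> i j; rewrite mxE ler01.
  - by split.
  - move=> i j; rewrite YE -(ler_pM2l A0) mulr0 mulrDr mulr1 mulVKf ?gt_eqF //.
    by have := XA i j; rewrite ler_norml => /andP[h _]; lra.
  - split=> [i|j].
      under eq_bigr do rewrite YE; rewrite big_split /= -mulr_sumr big_split /= sumrN.
      by rewrite rX sumr_const card_ord subrr mulr0 addr0.
    under eq_bigr do rewrite YE; rewrite big_split /= -mulr_sumr big_split /= sumrN.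
    by rewrite cX sumr_const card_ord subrr mulr0 addr0.
split; first by rewrite !big_ord_recl big_ord0 /= addr0 subrK.
rewrite !big_ord_recl big_ord0 /= addr0 /Y scalerDr scalerA mulfV ?gt_eqF // scale1r.
by rewrite scalerBl scale1r addrA subrK addrC subrK.
Qed.

Let proj X : 'rV[R]_(t * s) := mxvec (block X).

Lemma projE X i j : proj X ord0 (mxvec_index i j) = X (lift ord0 i) (lift ord0 j).
Proof. by rewrite /proj mxvecE mxE. Qed.

Lemma proj_inj X Y : in_span X -> in_span Y -> proj X = proj Y -> X = Y.
Proof.
move=> [rX cX] [rY cY] /(can_inj mxvecK) e.
by apply: block_margins_inj => // [i|j]; rewrite ?rX ?rY ?cX ?cY.
Qed.

Lemma proj_surj y : exists2 X, in_span X & proj X = y.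
Proof.
exists (const_mx 1 + zero_margin_ext (vec_mx y - const_mx 1)).
  split=> [i|j]; under eq_bigr do rewrite mxE.
    by rewrite big_split /= zero_margin_ext_row addr0; under eq_bigr do rewrite mxE;
      rewrite sumr_const card_ord.
  by rewrite big_split /= zero_margin_ext_col addr0; under eq_bigr do rewrite mxE;
    rewrite sumr_const card_ord.
apply: (can_inj vec_mxK); rewrite mxvecK; apply/matrixP => i j.
by rewrite !mxE !liftK !mxE addrC subrK.
Qed.

Lemma is_int_valE (x : R) : is_int_val x <-> x \is a Num.int.
Proof. by split=> [[z ->]|/intrP[z ->]]; [exact: intr_int|exists z]. Qed.

Lemma int_mx_block X :
    (forall i, \sum_j X i j \is a Num.int) -> (forall j, \sum_i X i j \is a Num.int) ->
    (forall i j, X (lift ord0 i) (lift ord0 j) \is a Num.int) ->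
  forall i j, X i j \is a Num.int.
Proof.
move=> rX cX bX.
have rowX i j : X (lift ord0 i) j \is a Num.int.
  case: (unliftP ord0 j) => [j' ->//|->]; have := rX (lift ord0 i).
  by rewrite big_ord_recl rpredDr // rpred_sum.
move=> i j; case: (unliftP ord0 i) => [i' ->//|->]; have := cX j.
by rewrite big_ord_recl rpredDr // rpred_sum.
Qed.

Lemma lattice_affine_iso_proj : lattice_affine_iso polytope proj.
Proof.
split; [|split; [|split]].
- move=> k p w _ _; apply/rowP => x; case/mxvec_indexP: x => i j.
  rewrite projE sum_mx_comb summxE; apply: eq_bigr => l _.
  by rewrite mxE projE.
- by move=> X Y /aff_span_transport HX /aff_span_transport HY; apply: proj_inj.
- by move=> y; have [X HX <-] := proj_surj y; exists X => //; apply/aff_span_transport.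
move=> X /aff_span_transport[rX cX]; split=> H i j.
  by rewrite [i]ord1; case/mxvec_indexP: j => i' j'; rewrite projE.
apply/is_int_valE; apply: int_mx_block => [i'|j'|i' j'].
- by rewrite rX rpred_nat.
- by rewrite cX rpred_nat.
by rewrite -projE; apply/is_int_valE.
Qed.

(** Multiplying by [n.+1] turns a point with block in the scaled lattice into a matrix whose block
    and margins are integral; the remaining entries are then integral too, and nonnegativity makes
    all of them naturals. *)
Lemma proj_scaled_points (n : nat) :
  scaled_lattice_points (fun y => exists2 X, polytope X & proj X = y) n.+1
    [seq mxvec (\matrix_(i < t, j < s) Posz ((x :
      'M[nat]_(t.+1, s.+1)) (lift ord0 i) (lift ord0 j)))
      | x <- margin_mxs t.+1 s.+1 (fun=> 0 + n.+1 * s.+1)%N (fun=> 0 + n.+1 * t.+1)%N].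
Proof.
have n0 : (n.+1%:R : R) != 0 by rewrite pnatr_eq0.
split.
  rewrite map_inj_in_uniq ?margin_mxs_uniq // => x y xm ym /(can_inj mxvecK) /matrixP e.
  apply: (@margins_block_inj _ _ (fun=> 0 + n.+1 * s.+1)%N (fun=> 0 + n.+1 * t.+1)%N);
    rewrite -?mem_margin_mxs // => i j.
  by have := e i j; rewrite !mxE => -[].
move=> z; split=> [/mapP[x + ->]|[X [X0 [rX cX]] XE]].
  rewrite mem_margin_mxs => /marginsP[rx cx].
  exists (\matrix_(i, j) (n.+1%:R^-1 * (x i j)%:R)).
    split; [|split].
    - by move=> i j; rewrite mxE mulr_ge0 ?invr_ge0 ?ler0n.
    - by move=> i; under eq_bigr do rewrite mxE; rewrite -mulr_sumr -natr_sum rx add0n natrM mulKf.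
    - by move=> j; under eq_bigr do rewrite mxE; rewrite -mulr_sumr -natr_sum cx add0n natrM mulKf.
  by apply/rowP => k; case/mxvec_indexP: k => i j; rewrite projE [RHS]mxE [in RHS]mxE mxvecE !mxE.
have blockX i j : n.+1%:R * X (lift ord0 i) (lift ord0 j) = (z ord0 (mxvec_index i j))%:~R.
  by rewrite -projE XE !mxE mulVKf.
have intX i j : (n.+1%:R *: X) i j \is a Num.int.
  apply: int_mx_block => [i'|j'|i' j'].
  - by under eq_bigr do rewrite mxE; rewrite -mulr_sumr rX -natrM rpred_nat.
  - by under eq_bigr do rewrite mxE; rewrite -mulr_sumr cX -natrM rpred_nat.
  by rewrite mxE blockX intr_int.
have natX i j : exists m : nat, n.+1%:R * X i j = m%:R.
  have /natrP[m mE] : n.+1%:R * X i j \is a Num.nat.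
    by have := intX i j; rewrite mxE natrEint => ->; rewrite mulr_ge0 ?ler0n.
  by exists m.
pose x : 'M[nat]_(t.+1, s.+1) := (\matrix_(i, j) sval (cid (natX i j))).
have xE i j : (x i j)%:R = n.+1%:R * X i j by rewrite mxE; case: (cid (natX i j)).
apply/mapP; exists x.
  rewrite mem_margin_mxs; apply/marginsP; split=> [i|j].
    apply: (mulrIn (oner_neq0 R)); rewrite natr_sum; under eq_bigr do rewrite xE.
    by rewrite -mulr_sumr rX add0n natrM.
  apply: (mulrIn (oner_neq0 R)); rewrite natr_sum; under eq_bigr do rewrite xE.
  by rewrite -mulr_sumr cX add0n natrM.
apply/rowP => k; case/mxvec_indexP: k => i j; rewrite mxvecE mxE.
by apply: (@intr_inj R); rewrite -blockX -xE.
Qed.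

(** The lattice points at scale n are counted by [H] at n, and dividing by n to the power [t * s]
    leaves the leading coefficient with an error of at most [A] / n. *)
Lemma relative_volume_transport (H : {poly rat}) (N : nat) :
    size H = (t * s).+1 ->
    (forall n, (N <= n)%N ->
       (transport_count t.+1 s.+1 (fun=> 0%N) (fun=> 0%N) n)%:R = H.[n%:R]) ->
  relative_volume_is polytope (ratr (lead_coef H)).
Proof.
move=> szH HN; exists (t * s)%N, proj; split; first exact: lattice_affine_iso_proj.
move=> e e0.
have szHR : (size (map_poly (ratr : rat -> R) H) <= (t * s).+1)%N by rewrite size_map_poly szH.
have [A HA] := horner_nat_asymptotic szHR.
exists (maxn N (Num.bound `|A / e|)) => n; rewrite geq_max => /andP[nN nA].
eexists; split; first exact: proj_scaled_points.
rewrite size_map -/(transport_count _ _ _ _ _).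
have n0 : 0 < n.+1%:R :> R by rewrite ltr0n.
have nd0 : 0 < (n.+1%:R : R) ^+ (t * s) by rewrite exprn_gt0.
have cE : (transport_count t.+1 s.+1 (fun=> 0%N) (fun=> 0%N) n.+1)%:R = (map_poly (ratr :
  rat -> R) H).[n.+1%:R].
  by rewrite -[LHS](ratr_nat R) HN ?leqW // -[in RHS](ratr_nat R) horner_map.
rewrite cE; have := HA n.+1 isT;
  rewrite coef_map /= -[H`_(t * s)]/(H`_((t * s).+1.-1)) -szH -lead_coefE.
set v := _.[_]; set l := ratr _ => le1.
have -> : v / n.+1%:R ^+ (t * s) - l = (v - l * n.+1%:R ^+ (t * s)) / n.+1%:R ^+ (t * s).
  by rewrite mulrBl mulfK ?gt_eqF.
rewrite normrM normfV (ger0_norm (ltW nd0)) ltr_pdivrMr // -(ltr_pM2r n0).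
apply: le_lt_trans le1 _; rewrite mulrAC ltr_pM2r // mulrC -ltr_pdivrMr //.
apply: le_lt_trans (ler_norm _) _; apply: lt_le_trans (archi_boundP (normr_ge0 _)) _.
by rewrite ler_nat leqW.
Qed.

End TransportVolume.

(** * The abacus *)

Section Abacus.

Implicit Types lam mu nu : seq nat.

Lemma partition_sorted lam : is_partition lam -> sorted geq lam.
Proof. by case/andP. Qed.

Lemma nth_partition_le lam i j : is_partition lam -> i <= j -> nth 0 lam j <= nth 0 lam i.
Proof.
move=> /partition_sorted so ij; have [jl|lj] := ltnP j (size lam); last by rewrite nth_default.
by apply: (sorted_leq_nth (rev_trans leq_trans) leqnn 0 so) => //; apply: leq_ltn_trans jl.
Qed.

Lemma nth_partition_gt0 lam i : is_partition lam -> (0 < nth 0 lam i) = (i < size lam).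
Proof.
case/andP => _ /allP pos; have [il|li] := ltnP i (size lam); last by rewrite nth_default.
by rewrite pos // mem_nth.
Qed.

Lemma partition_ext lam mu :
  is_partition lam -> is_partition mu -> (forall i, nth 0 lam i = nth 0 mu i) -> lam = mu.
Proof.
move=> pl pm e; apply: (@eq_from_nth _ 0) => //; apply/eqP; rewrite eqn_leq.
by apply/andP; split; rewrite leqNgt -nth_partition_gt0 //; [rewrite e|rewrite -e];
  rewrite nth_default.
Qed.

Lemma nth_filter_pos (l : seq nat) i :
  sorted geq l -> nth 0 [seq a <- l | 0 < a] i = nth 0 l i.
Proof.
elim: l i => //= a l IH i pl; have sl := path_sorted pl.
case: ifP => [_|/negbT]; first by case: i => //= i; apply: IH.
rewrite -eqn0Ngt => /eqP a0; have all0 : all (fun b => b == 0) l.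
  move: pl; rewrite a0 path_sortedE; last exact: rev_trans leq_trans.
  by case/andP => h _; apply: sub_all h => b; rewrite /= leqn0.
have -> : [seq a <- l | 0 < a] = [::].
  apply/eqP; rewrite -[_ == _]negbK -has_filter -all_predC.
  by apply: sub_all all0 => b /= /eqP->.
rewrite nth_nil; case: i => [//|i] /=.
have [il|li] := ltnP i (size l); last by rewrite nth_default.
by apply/esym/eqP; have /allP := all0; apply; rewrite mem_nth.
Qed.

Definition partition_of (k : nat) (f : nat -> nat) : seq nat :=
  [seq a <- mkseq f k | 0 < a].

Lemma partition_ofP (k : nat) (f : nat -> nat) :
    (forall i, i.+1 < k -> f i.+1 <= f i) ->
  [/\ is_partition (partition_of k f), size (partition_of k f) <= k &
      forall i, nth 0 (partition_of k f) i = if i < k then f i else 0].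
Proof.
move=> fd; have so : sorted geq (mkseq f k).
  by apply/(sortedP 0) => i; rewrite size_mkseq => ik; rewrite !nth_mkseq ?(ltnW ik) //=; apply: fd.
split.
- rewrite /is_partition filter_all sorted_filter //; exact: rev_trans leq_trans.
- by rewrite size_filter (leq_trans (count_size _ _)) // size_mkseq.
move=> i; rewrite nth_filter_pos //; case: ltnP => ik; first by rewrite nth_mkseq.
by rewrite nth_default // size_mkseq.
Qed.

(** The beta-numbers of [lam] for [k] beads; rows past the end of [lam] count as 0 through the
    default of [nth]. *)
Definition bead (k : nat) lam i := nth 0 lam i + (k - i.+1).
Definition beads (k : nat) lam : seq nat := mkseq (bead k lam) k.

Lemma beadsP (k : nat) lam x :
  reflect (exists2 i, i < k & x = bead k lam i) (x \in beads k lam).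
Proof.
apply: (iffP mapP) => [[i]|[i ik ->]]; first by rewrite mem_iota => /andP[_ ik] ->; exists i.
by exists i; rewrite // mem_iota.
Qed.

Lemma bead_lt (k : nat) lam i j : is_partition lam -> i < j < k -> bead k lam j < bead k lam i.
Proof.
move=> pl /andP[ij jk]; rewrite /bead.
have := nth_partition_le pl (ltnW ij); lia.
Qed.

Lemma beads_sorted (k : nat) lam : is_partition lam -> sorted gtn (beads k lam).
Proof.
move=> pl; apply/(sortedP 0) => i; rewrite size_mkseq => ik.
by rewrite !nth_mkseq ?(ltnW ik) // /= bead_lt // ltnSn.
Qed.

Lemma gtn_trans : transitive gtn.
Proof. exact: rev_trans ltn_trans. Qed.

Lemma beads_uniq (k : nat) lam : is_partition lam -> uniq (beads k lam).
Proof. by move=> pl; apply: sorted_uniq (beads_sorted k pl); [exact: gtn_trans|exact: ltnn]. Qed.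

Lemma beads_inj (k : nat) lam mu :
    is_partition lam -> is_partition mu -> size lam <= k -> size mu <= k ->
  beads k lam =i beads k mu -> lam = mu.
Proof.
move=> pl pm sl sm /(irr_sorted_eq gtn_trans ltnn (beads_sorted k pl) (beads_sorted k pm)) e.
apply: partition_ext => // i; have [ik|ki] := ltnP i k.
  by have /(congr1 (fun l => nth 0 l i)) := e; rewrite !nth_mkseq // => /addIn.
by rewrite !nth_default // (leq_trans _ ki).
Qed.

Lemma sumn_beads (k : nat) lam :
  size lam <= k -> sumn (beads k lam) = sumn lam + \sum_(i < k) (k - i.+1).
Proof.
move=> sl; rewrite !sumnE (big_nth 0) big_mkord [X in _ = X + _](big_nth 0) big_mkord size_mkseq.
have -> : \sum_(i < size lam) nth 0 lam i = \sum_(i < k) nth 0 lam i.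
  rewrite -!(big_mkord xpredT (fun i => nth 0 lam i)).
  rewrite [RHS](@big_cat_nat _ _ _ (size lam)) //= [X in _ = _ + X]big_nat.
  by rewrite [X in _ = _ + X]big1 ?addn0 // => i /andP[li _]; rewrite nth_default.
by rewrite -big_split; apply: eq_bigr => i _; rewrite nth_mkseq.
Qed.

(** Row [r] is the last one whose bead lies above the gap [y]. Since [y] is vacant, the next bead
    lies strictly below it, which is why the bound has [k - r.+1]: column [y - (k - r.+1)] then ends
    exactly in row [r]. *)
Lemma bead_gap (k : nat) lam y i :
    is_partition lam -> size lam <= k -> y \notin beads k lam -> i < k -> y < bead k lam i ->
  exists r, [/\ i <= r < k, y < bead k lam r & nth 0 lam r.+1 + (k - r.+1) <= y].
Proof.
move=> pl sl yB ik yi.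
have exP : exists m, (m < k) && (y < bead k lam m) by exists i; rewrite ik.
have bd m : (m < k) && (y < bead k lam m) -> m <= k by case/andP => /ltnW.
case: (ex_maxnP exP bd) => r /andP[rk yr] rmax; exists r.
rewrite rk yr rmax ?ik //; split=> //.
have [rk'|kr] := ltnP r.+1 k; last first.
  by rewrite nth_default ?(leq_trans sl) // add0n; move: kr yr; rewrite /bead; lia.
have : bead k lam r.+1 <= y.
  by rewrite leqNgt; apply/negP => lt; have := rmax r.+1; rewrite rk' lt ltnn => /(_ isT).
have : bead k lam r.+1 != y by apply: contraNneq yB => <-; apply/beadsP; exists r.+1.
rewrite /bead; lia.
Qed.

Lemma notin_beads (k : nat) lam y r :
    is_partition lam -> y < bead k lam r -> nth 0 lam r.+1 + (k - r.+1) <= y -> r < k ->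
  y \notin beads k lam.
Proof.
move=> pl; rewrite /bead => yr ry rk; apply/beadsP => -[m mk]; rewrite /bead => yE.
have [mr|rm] := leqP m r; first by have := nth_partition_le pl mr; lia.
by have := nth_partition_le pl rm; lia.
Qed.

(** The count is the length of column [j], so this is the symmetry between a partition and its
    conjugate. *)
Lemma ltn_count_gt lam j i : is_partition lam ->
  (i < count (fun a => j < a) lam) = (j < nth 0 lam i).
Proof.
rewrite /is_partition; elim: lam i => [|a l IH] i; first by rewrite nth_nil.
move=> pl; have pl' : is_partition l.
  by rewrite /is_partition; case/andP: pl => /= /path_sorted -> /andP[_ ->].
have le0 m : nth 0 l m <= a by have := nth_partition_le pl (leq0n m.+1).
rewrite /=; case: (ltnP j a) => ja.
  by case: i => [|i] /=; rewrite ?ja ?add1n ?ltnS ?IH.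
rewrite add0n IH // ltnNge (leq_trans (le0 i) ja); case: i => [|i] /=; rewrite ltnNge ?ja //.
by rewrite (leq_trans (le0 i) ja).
Qed.

Lemma leg_eq lam i r j : is_partition lam -> i <= r -> j < nth 0 lam r -> nth 0 lam r.+1 <= j ->
  count (fun a => j < a) (drop i.+1 lam) = r - i.
Proof.
move=> pl ir jr rj.
have pd : is_partition (drop i.+1 lam).
  case/andP: pl => so pos; rewrite /is_partition drop_sorted //=.
  by apply/allP => a /mem_drop; apply/allP.
have H m : (m < count (fun a => j < a) (drop i.+1 lam)) = (j < nth 0 lam (i.+1 + m)).
  by rewrite ltn_count_gt // nth_drop.
apply/eqP; rewrite eqn_leq; apply/andP; split.
  by rewrite leqNgt H addSn subnKC // -leqNgt.
have [e|lt] := posnP (r - i); first by rewrite e.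
rewrite -(prednK lt) H (_ : i.+1 + (r - i).-1 = r) //; lia.
Qed.

Definition flush (t : nat) (B : seq nat) := forall x, x \in B -> t <= x -> x - t \in B.

(** A hook of length h in row i corresponds to a vacant position h below the bead of row i: the
    column is read off from the gap, and the leg counts the beads jumped over. *)
Lemma tcore_flush (t k : nat) lam :
  0 < t -> is_partition lam -> size lam <= k -> is_tcore t lam <-> flush t (beads k lam).
Proof.
move=> t0 pl sl; split=> [core x /beadsP[i ik ->] tx|fl i j il ji hook].
  apply: contraT => yB.
  have [|r [/andP[ir rk] yr ry]] := bead_gap pl sl yB ik; first by lia.
  pose j := bead k lam i - t - (k - r.+1).
  have jr : j < nth 0 lam r by move: yr ry; rewrite /j /bead; lia.
  have rj : nth 0 lam r.+1 <= j by move: yr ry; rewrite /j /bead; lia.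
  have ri := nth_partition_le pl ir.
  case: (core i j); rewrite -?nth_partition_gt0 //; first by lia.
    by lia.
  by rewrite /hook_length (leg_eq pl ir jr rj); move: yr ry tx ri jr; rewrite /j /bead; lia.
set l := count (fun a => j < a) (drop i.+1 lam) in hook.
have pd : is_partition (drop i.+1 lam).
  case/andP: pl => so pos; rewrite /is_partition drop_sorted //=.
  by apply/allP => a /mem_drop; apply/allP.
have H m : (m < l) = (j < nth 0 lam (i.+1 + m)) by rewrite ltn_count_gt // nth_drop.
have jr : j < nth 0 lam (i + l).
  by case: (l) H => [|l'] H; rewrite ?addn0 // -addSnnS -H.
have rj : nth 0 lam (i + l).+1 <= j by rewrite leqNgt -addSn -H ltnn.
have rk : i + l < k.
  by apply: leq_trans sl; rewrite -nth_partition_gt0 //; apply: leq_ltn_trans jr.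
have ik : i < k by apply: leq_ltn_trans rk; apply: leq_addr.
have := notin_beads (y := j + (k - (i + l).+1)) pl _ _ rk.
rewrite leq_add2r /bead ltn_add2r jr rj => /(_ isT isT) /negP; apply.
have e : bead k lam i - t = j + (k - (i + l).+1).
  by rewrite -hook /hook_length -/l /bead; lia.
rewrite -e; apply: fl; first by apply/beadsP; exists i.
by rewrite -hook /hook_length -/l /bead; lia.
Qed.

(** Inside the strip, [lam] at row i + 1 and [mu] at row i have the same bead. Only the bead of
    [lam] at the top row disappears, and only the bead of [mu] at the bottom row is new. *)
Lemma rim_hook_beads (k r r' : nat) lam mu :
    r <= r' < k ->
    (forall i, (i < r) || (r' < i) -> nth 0 mu i = nth 0 lam i) ->
    (forall i, r <= i < r' -> nth 0 lam i.+1 = (nth 0 mu i).+1) ->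
  perm_eq (bead k lam r :: beads k mu) (bead k mu r' :: beads k lam).
Proof.
move=> /andP[rr' rk] out inn; rewrite /beads /mkseq.
have kE : k = r + ((r' - r).+1 + (k - r'.+1)) by lia.
rewrite [in iota 0 k]kE !iotaD add0n (_ : r + (r' - r).+1 = r'.+1); last by lia.
rewrite !map_cat.
have outE l n : (forall i, i \in iota l n -> (i < r) || (r' < i)) ->
    [seq bead k mu i | i <- iota l n] = [seq bead k lam i | i <- iota l n].
  by move=> H; apply/eq_in_map => i /H; rewrite /bead => /out->.
rewrite (outE 0 r) ?(outE r'.+1) => [|i|i]; rewrite ?mem_iota; try lia.
have -> : [seq bead k mu i | i <- iota r (r' - r).+1] =
    rcons [seq bead k lam i | i <- iota r.+1 (r' - r)] (bead k mu r').
  rewrite -addn1 iotaD map_cat cats1 /= subnKC //; congr rcons.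
  rewrite -[r.+1]add1n iotaDl -map_comp; apply/eq_in_map => i; rewrite mem_iota => /andP[ri ir].
  have ir' : i < r' by lia.
  by rewrite /bead /= add1n inn ?ri //; lia.
apply/permP => p; rewrite /= !count_cat /= -cats1 count_cat /= count_cat addn0.
move: (count _ _) (count _ _) (count _ _) (nat_of_bool _) (nat_of_bool _) => *; lia.
Qed.

(** The drop of the moved bead is found by comparing sums of bead positions, which differ by [t]
    since the partitions do. *)
Lemma remove_rim_hook_beads (t k : nat) lam mu :
    is_partition lam -> size lam <= k -> remove_rim_hook t lam mu ->
  [/\ is_partition mu, size mu <= k &
    exists x y, x = y + t /\ perm_eq (x :: beads k mu) (y :: beads k lam)].
Proof.
move=> pl sl [pm [sum [r [r' [rr' [out [lt inn]]]]]]].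
have rk : r' < k.
  by apply: leq_trans sl; rewrite -nth_partition_gt0 //; apply: leq_ltn_trans (lt r' _);
    rewrite ?rr' /=.
have sm : size mu <= k.
  rewrite leqNgt -nth_partition_gt0 // out ?rk ?orbT //.
  by rewrite nth_default.
split=> //; exists (bead k lam r), (bead k mu r').
have := @rim_hook_beads k r r' lam mu _ out inn; rewrite rr' rk => /(_ isT) pe; split=> //.
by have := perm_sumn pe; rewrite /= !sumn_beads // sum; lia.
Qed.

Lemma exists_rim_hook (t k : nat) lam :
    0 < t -> is_partition lam -> size lam <= k -> ~ flush t (beads k lam) ->
  exists mu, remove_rim_hook t lam mu.
Proof.
move=> t0 pl sl /existsNP[x /not_implyP[/beadsP[i ik xi] /not_implyP[tx /negP yB]]].
have [|r' [/andP[ir rk] yr ry]] := bead_gap pl sl yB ik; first by lia.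
pose y := x - t; rewrite -/y in yB yr ry.
(* Rows from [i] to just before [r'] take the next row's length minus one, and row [r'] is cut back
   so that its bead sits at [y]. *)
pose g m := if (m < i) || (r' < m) then nth 0 lam m
  else if m < r' then (nth 0 lam m.+1).-1 else y - (k - r'.+1).
have mono m : nth 0 lam m.+1 <= nth 0 lam m by apply: nth_partition_le.
have gr : y - (k - r'.+1) < nth 0 lam r' by move: yr ry; rewrite /bead; lia.
have gr' : nth 0 lam r'.+1 <= y - (k - r'.+1) by lia.
have pos m : m <= r' -> 0 < nth 0 lam m.
  by move=> /(nth_partition_le pl); apply: leq_trans; apply: leq_ltn_trans gr.
have [|pm sm nm] := @partition_ofP k g.
  move=> m mk; rewrite /g; have := mono m; have := mono m.+1.
  have [e|ne] := eqVneq m r'; first by rewrite e ltnSn ltnn orbT orbF; case: ifP; lia.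
  have [e|ne'] := eqVneq m.+1 r'.
    have -> : r' < m = false by lia.
    have -> : r' < m.+1 = false by lia.
    have -> : m < r' by lia.
    have -> : m.+1 < r' = false by lia.
    rewrite !orbF; move: gr; rewrite -e; case: (ltnP m.+1 i); case: (ltnP m i); lia.
  have [mr|rm] := ltnP m r'.
    have -> : r' < m = false by lia.
    have -> : r' < m.+1 = false by lia.
    have -> : m.+1 < r' by lia.
    rewrite !orbF; case: (ltnP m.+1 i); case: (ltnP m i); lia.
  have -> : r' < m by lia.
  have -> : r' < m.+1 by lia.
  by rewrite !orbT; lia.
have out m : (m < i) || (r' < m) -> nth 0 (partition_of k g) m = nth 0 lam m.
  move=> om; rewrite nm; case: ltnP => [mk|km]; first by rewrite /g om.
  by rewrite nth_default // (leq_trans sl).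
have inn m : i <= m < r' -> nth 0 lam m.+1 = (nth 0 (partition_of k g) m).+1.
  move=> /andP[im mr]; rewrite nm (ltn_trans mr rk) /g ltnNge im mr ltnNge (ltnW mr) /=.
  by rewrite prednK // pos.
have lastE : nth 0 (partition_of k g) r' = y - (k - r'.+1).
  by rewrite nm rk /g !ltnn orbF ltnNge ir.
exists (partition_of k g); split=> //; split.
  have := @rim_hook_beads k i r' lam (partition_of k g) _ out inn;
    rewrite ir rk => /(_ isT) /perm_sumn.
  rewrite /= !sumn_beads // -xi {1}/bead lastE; move: tx yr ry; rewrite /y; lia.
exists i, r'; do 2?split=> //; split=> // m /andP[im].
rewrite leq_eqVlt => /predU1P[->|mr]; first by rewrite lastE.
by have := inn m; rewrite im mr => /(_ isT) e; have := mono m; lia.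
Qed.

End Abacus.

(** * Cores and bead counts *)

Section Cores.

Implicit Types lam mu nu sig : seq nat.

Definition residue_count (t i : nat) (B : seq nat) := count (fun x => x %% t == i) B.

Lemma rim_reduces_residue_count (t k : nat) lam mu :
    rim_reduces t lam mu -> is_partition lam -> size lam <= k ->
  [/\ is_partition mu, size mu <= k &
      forall i, residue_count t i (beads k mu) = residue_count t i (beads k lam)].
Proof.
elim=> // {}lam {}mu nu rim _ IH pl sl.
have [pm sm [x [y [xy /permP pe]]]] := remove_rim_hook_beads pl sl rim.
have [pn sn e] := IH pm sm; split=> // i; rewrite e.
by have := pe (fun x => x %% t == i); rewrite /= xy modnDr => /addnI.
Qed.

Lemma initial_segment (l : seq nat) :
  uniq l -> (forall q, q.+1 \in l -> q \in l) -> forall q, (q \in l) = (q < size l).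
Proof.
move=> ul dl q; have down m d : m + d \in l -> m \in l.
  by elim: d => [|d IH]; rewrite ?addn0 // addnS => /dl.
apply/idP/idP => [ql|].
  rewrite -[q.+1](size_iota 0); apply: uniq_leq_size; first exact: iota_uniq.
  by move=> m; rewrite mem_iota add0n ltnS => /andP[_ mq]; apply: (down m (q - m)); rewrite subnKC.
apply: contraTT => ql; rewrite -leqNgt -[X in _ <= X](size_iota 0 q);
  apply: uniq_leq_size => // m ml.
rewrite mem_iota add0n ltnNge /=; apply: contra ql => qm.
by apply: (down q (m - q)); rewrite subnKC.
Qed.

(** On each runner modulo [t] a flush set occupies an initial segment, whose length is the number of
    beads on the runner. *)
Lemma mem_flush (t : nat) (B : seq nat) (x : nat) :
  0 < t -> uniq B -> flush t B -> (x \in B) = (x %/ t < residue_count t (x %% t) B).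
Proof.
move=> t0 uB fl; pose r := x %% t.
pose l := [seq y %/ t | y <- B & y %% t == r].
have rt : r < t by rewrite ltn_mod.
have ml q : (q \in l) = (q * t + r \in B).
  apply/mapP/idP => [[y + ->]|qB].
    by rewrite mem_filter => /andP[/eqP <- yB]; rewrite -divn_eq.
  exists (q * t + r); last by rewrite divnMDl // divn_small // addn0.
  by rewrite mem_filter modnMDl modn_small // eqxx.
have ul : uniq l.
  rewrite map_inj_in_uniq ?filter_uniq // => y z;
    rewrite !mem_filter => /andP[/eqP yr _] /andP[/eqP zr _] e.
  by rewrite (divn_eq y t) (divn_eq z t) e yr zr.
have szl : size l = residue_count t r B by rewrite size_map size_filter.
rewrite -/r -szl -initial_segment // => [|q]; first by rewrite ml -divn_eq.
rewrite !ml => /fl; rewrite mulSn -addnA leq_addr => /(_ isT).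
by rewrite addKn.
Qed.

Lemma flush_inj (t k : nat) lam mu :
    0 < t -> is_partition lam -> is_partition mu -> size lam <= k -> size mu <= k ->
    flush t (beads k lam) -> flush t (beads k mu) ->
    (forall i, residue_count t i (beads k lam) = residue_count t i (beads k mu)) ->
  lam = mu.
Proof.
move=> t0 pl pm sl sm fl fm e; apply: (beads_inj pl pm sl sm) => x.
by rewrite (mem_flush _ t0 (beads_uniq k pl) fl) (mem_flush _ t0 (beads_uniq k pm) fm) e.
Qed.

Lemma exists_core (t : nat) lam : 0 < t ->
  exists nu, rim_reduces t lam nu /\ forall mu, ~ remove_rim_hook t nu mu.
Proof.
move=> t0; have [n] := ubnP (sumn lam); elim: n lam => // n IH lam; rewrite ltnS => sn.
have [[mu rim]|none] := pselect (exists mu, remove_rim_hook t lam mu); last first.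
  by exists lam; split; [exact: rim_refl|move=> mu rim; apply: none; exists mu].
have [|nu [red nocore]] := IH mu; first by have [_ [+ _]] := rim; lia.
by exists nu; split=> //; apply: rim_step red.
Qed.

(** Removing rim hooks keeps every bead on its runner. Conversely, any core reached from [lam] is
    flush with the same runner counts as [sig], and a flush set is determined by its counts. *)
Lemma is_core_ofE (t k : nat) lam sig :
    0 < t -> is_partition lam -> size lam <= k -> is_partition sig -> size sig <= k ->
    is_tcore t sig ->
  is_core_of t lam sig <->
  forall i, residue_count t i (beads k lam) = residue_count t i (beads k sig).
Proof.
move=> t0 pl sl ps ss /(tcore_flush t0 ps ss) fs; split=> [[red _] i|e].
  by have [_ _ ->] := rim_reduces_residue_count red pl sl.
have [nu [red none]] := exists_core lam t0.
have [pn sn en] := rim_reduces_residue_count red pl sl.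
have fn : flush t (beads k nu).
  by apply: contrapT => nf; have [mu] := exists_rim_hook t0 pn sn nf; apply: none.
by rewrite -(flush_inj t0 pn ps sn ss fn fs) // => i; rewrite en.
Qed.

Lemma beads_recS (k : nat) lam :
  size lam <= k -> beads k.+1 lam = rcons (map S (beads k lam)) 0.
Proof.
move=> sl; rewrite /beads /mkseq -addn1 iotaD map_cat cats1 /= add0n.
rewrite {2}/bead nth_default // addn1 subnn; congr rcons.
rewrite -map_comp; apply/eq_in_map => i; rewrite mem_iota /= /bead => ik; lia.
Qed.

Lemma beadsD (k m : nat) lam :
  size lam <= k -> beads (k + m) lam = map (addn m) (beads k lam) ++ rev (iota 0 m).
Proof.
move=> sl; elim: m => [|m IH].
  by rewrite addn0 cats0 -[LHS]map_id; apply: eq_map.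
rewrite addnS beads_recS ?(leq_trans sl) ?leq_addr // IH map_cat rcons_cat -map_comp.
congr (_ ++ _); rewrite -[iota 0 m.+1]/(0 :: iota (1 + 0) m) iotaDl rev_cons.
by rewrite -map_rev.
Qed.

(** Adding [t] beads moves all beads up by [t], which preserves residues, and fills the positions
    below [t], one on each runner. *)
Lemma residue_count_shift (t k n i : nat) lam :
    i < t -> size lam <= k ->
  residue_count t i (beads (k + n * t) lam) = residue_count t i (beads k lam) + n.
Proof.
move=> it sl; elim: n => [|n IH]; first by rewrite !addn0.
rewrite mulSn addnCA addnC beadsD ?(leq_trans sl) ?leq_addr //.
rewrite /residue_count count_cat count_map count_rev addnS -addn1 -IH; congr (_ + _).
  by apply: eq_count => x /=; rewrite modnDl.
rewrite (@eq_in_count _ _ (pred1 i)) => [|x]; last by rewrite mem_iota => /= xt; rewrite modn_small.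
by rewrite count_uniq_mem ?iota_uniq // mem_iota it.
Qed.

End Cores.

(** * Simultaneous core conditions as margins of a matrix *)

Section CoreCount.

Lemma sum_count_modn (m : nat) (p : pred nat) (B : seq nat) :
  \sum_(i < m.+1) count (fun y => p y && (y %% m.+1 == i)) B = count p B.
Proof.
elim: B => [|y B IH] /=; first by rewrite big1.
rewrite big_split /= IH; congr (_ + _).
rewrite (bigD1 (Ordinal (ltn_pmod y (ltn0Sn m)))) //= eqxx andbT big1 ?addn0 // => i ne.
by case: eqP => [e|]; rewrite ?andbF //; case/eqP: ne; apply: val_inj.
Qed.

Lemma sum_residue_count (m : nat) (B : seq nat) :
  \sum_(i < m.+1) residue_count m.+1 i B = size B.
Proof. by rewrite -(count_predT B) -(sum_count_modn m). Qed.

Variables t s k : nat.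
Local Notation T := t.+1.
Local Notation S := s.+1.
Local Notation mx := 'M[nat]_(T, S).
Hypothesis coTS : coprime T S.

Definition joint_count (i j : nat) (B : seq nat) :=
  count (fun y => (y %% T == i) && (y %% S == j)) B.

Lemma joint_count_residue (B : seq nat) (x : nat) :
  residue_count (T * S) (x %% (T * S)) B = joint_count (x %% T) (x %% S) B.
Proof. by apply: eq_count => y; rewrite chinese_remainder. Qed.

Definition at_residues (x : mx) (y : nat) : nat := x (inord (y %% T)) (inord (y %% S)).

(** The flush abacus with [x i j] beads on the runner of residues (i, j). The search bound contains
    every bead when the entries are at most [k], and [rev] gives the decreasing order used by
    [beads]. *)
Definition flush_beads (x : mx) : seq nat :=
  rev [seq y <- iota 0 (T * S * k.+1) | y %/ (T * S) < at_residues x y].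

Lemma at_residues_sub (x : mx) (y : nat) :
  T * S <= y -> at_residues x (y - T * S) = at_residues x y.
Proof.
move=> le; rewrite /at_residues; have yE := subnK le.
have -> : y %% T = (y - T * S) %% T by rewrite -{1}yE -modnDmr modnMr addn0.
by have -> : y %% S = (y - T * S) %% S by rewrite -{1}yE -modnDmr modnMl addn0.
Qed.

Lemma flush_beads_flush (x : mx) : flush (T * S) (flush_beads x).
Proof.
move=> y; rewrite !mem_rev !mem_filter !mem_iota add0n !leq0n /= => /andP[lt yk] le.
rewrite at_residues_sub // (leq_ltn_trans (leq_subr _ _) yk) andbT.
by apply: leq_ltn_trans lt; apply: leq_div2r; apply: leq_subr.
Qed.

Lemma flush_beads_uniq (x : mx) : uniq (flush_beads x).
Proof. by rewrite rev_uniq filter_uniq // iota_uniq. Qed.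

Lemma mem_flush_beads (x : mx) (y : nat) :
  (forall i j, x i j <= k) -> (y \in flush_beads x) = (y %/ (T * S) < at_residues x y).
Proof.
move=> xk; rewrite mem_rev mem_filter mem_iota add0n leq0n /= andb_idr // => lt.
rewrite mulnC -ltn_divLR ?muln_gt0 //; apply: leq_trans lt _; exact: leqW (xk _ _).
Qed.

Lemma joint_count_flush_beads (x : mx) (i : 'I_T) (j : 'I_S) :
  (forall i j, x i j <= k) -> joint_count i j (flush_beads x) = x i j.
Proof.
move=> xk; pose r := chinese T S i j %% (T * S).
have TS0 : 0 < T * S by rewrite muln_gt0.
have rT : r %% T = i by rewrite /r modn_dvdm ?dvdn_mulr // chinese_modl // modn_small.
have rS : r %% S = j by rewrite /r modn_dvdm ?dvdn_mull // chinese_modr // modn_small.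
(* Two naturals with the same smaller elements are equal; position [q] of the runner is tested
   against both descriptions of the bead set. *)
have key q : (q < joint_count i j (flush_beads x)) = (q < x i j).
  have qT : (q * (T * S) + r) %% T = i by rewrite mulnCA mulnC modnMDl.
  have qS : (q * (T * S) + r) %% S = j by rewrite mulnA modnMDl.
  have qd : (q * (T * S) + r) %/ (T * S) = q.
    by rewrite divnMDl // divn_small ?addn0 // ltn_mod.
  have := mem_flush (q * (T * S) + r) TS0 (flush_beads_uniq x) (@flush_beads_flush x).
  rewrite mem_flush_beads // joint_count_residue qd qT qS => <-.
  by rewrite /at_residues qT qS !inord_val.
apply/eqP; rewrite eqn_leq; apply/andP; split; rewrite leqNgt.
  by rewrite key ltnn.
by rewrite -key ltnn.
Qed.

(* Flush bead sets modulo st correspond to t x s matrices, the (i, j) entry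
   being the number of beads congruent to i mod t and to j mod s. *)
Lemma core_count_transport (sigma tau : seq nat) :
    is_partition sigma -> is_tcore S sigma -> size sigma <= k ->
    is_partition tau -> is_tcore T tau -> size tau <= k ->
  exists l : seq (seq nat), [/\ uniq l,
    forall lam, lam \in l <-> [/\ is_partition lam, is_tcore (S * T) lam,
      is_core_of S lam sigma, is_core_of T lam tau & plength lam <= k] &
    size l = size (margin_mxs T S (fun i => residue_count T i (beads k tau))
                                  (fun j => residue_count S j (beads k sigma)))].
Proof.
move=> psig csig ssig ptau ctau stau; 
pose b i := residue_count T i (beads k tau); pose c j := residue_count S j (beads k sigma).
have TS0 : 0 < T * S by rewrite muln_gt0.
pose g x := partition_of k (fun i => nth 0 (flush_beads x) i - (k - i.+1)).
have entry x i j : x \in margin_mxs T S b c -> x i j <= k.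
  rewrite mem_margin_mxs => /marginsP[rx _].
  have : b i <= k by rewrite -[k](size_mkseq (bead k tau)) count_size.
  by apply: leq_trans; rewrite -rx (bigD1 j) //= leq_addr.
have rowE x i : x \in margin_mxs T S b c -> i < T -> residue_count T i (flush_beads x) = b i.
  move=> xm iT; have xk := fun i j => entry x i j xm.
  have /marginsP[/(_ (Ordinal iT)) /= <- _] : margins b c x by rewrite -mem_margin_mxs.
  rewrite /residue_count -(sum_count_modn s); apply: eq_bigr => j _.
  exact: (joint_count_flush_beads (Ordinal iT) j xk).
have colE x j : x \in margin_mxs T S b c -> j < S -> residue_count S j (flush_beads x) = c j.
  move=> xm jS; have xk := fun i j => entry x i j xm.
  have /marginsP[_ /(_ (Ordinal jS)) /= <-] : margins b c x by rewrite -mem_margin_mxs.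
  rewrite /residue_count -(sum_count_modn t); apply: eq_bigr => i _.
  rewrite -(joint_count_flush_beads i (Ordinal jS) xk) /=.
  by apply: eq_count => y; rewrite andbC.
have size_fb x : x \in margin_mxs T S b c -> size (flush_beads x) = k.
  move=> xm; rewrite -(sum_residue_count t) (eq_bigr (fun i : 'I_T => b i)) => [|i _].
    by rewrite sum_residue_count size_mkseq.
  exact: rowE.
have fb_sorted x : sorted gtn (flush_beads x).
  by rewrite rev_sorted sorted_filter ?iota_ltn_sorted //; exact: ltn_trans.
have beadsE x : x \in margin_mxs T S b c ->
    [/\ is_partition (g x), size (g x) <= k & beads k (g x) = flush_beads x].
  move=> xm; have szx := size_fb x xm; have so := fb_sorted x.
  have dec i : i.+1 < k -> nth 0 (flush_beads x) i.+1 < nth 0 (flush_beads x) i.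
    by move=> ik; move/(sortedP 0): so; apply; rewrite szx.
  (* A strictly decreasing list of [k] naturals dominates the staircase, so the truncated
     subtraction in [g] loses nothing. *)
  have low i : i < k -> k - i.+1 <= nth 0 (flush_beads x) i.
    move=> ik; have [d kE] : exists d, k = i + d.+1 by exists (k - i.+1); lia.
    have -> : k - i.+1 = d by lia.
    elim: d i ik kE => // d IH i ik kE.
    by apply: leq_ltn_trans (dec i _); [apply: IH; lia|lia].
  have [|pg sg ng] := @partition_ofP k (fun i => nth 0 (flush_beads x) i - (k - i.+1)).
    by move=> i ik; have := dec i ik; lia.
  split=> //; apply: (@eq_from_nth _ 0); rewrite size_mkseq ?szx // => i ik.
  by rewrite nth_mkseq // /bead ng ik subnK // low.
(* [is_core_ofE] compares counts for all [i], including values that are not residues, where both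
   sides vanish. *)
have residue_lt m B i : m <= i -> 0 < m -> residue_count m i B = 0.
  move=> mi m0; rewrite /residue_count (eq_count (a2 := pred0)) ?count_pred0 // => y /=.
  by apply/negbTE; rewrite neq_ltn (leq_trans (ltn_pmod y m0) mi).
exists [seq g x | x <- margin_mxs T S b c]; rewrite size_map; split=> //.
  rewrite map_inj_in_uniq ?margin_mxs_uniq // => x y xm ym e.
  have [_ _ ex] := beadsE x xm; have [_ _ ey] := beadsE y ym.
  apply/matrixP => i j.
  rewrite -(joint_count_flush_beads i j (fun i j => entry x i j xm)) -ex e ey.
  exact: joint_count_flush_beads (fun i j => entry y i j ym).
move=> lam; split=> [/mapP[x xm ->]|[pl cl csl ctl sl]].
  have [pg sg eg] := beadsE x xm; split=> //.
  - rewrite mulnC; apply/(tcore_flush TS0 pg sg); rewrite eg; exact: flush_beads_flush.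
  - apply/(@is_core_ofE S k) => // j; rewrite eg; have [jS|Sj] := ltnP j S; first exact: colE.
    by rewrite !residue_lt.
  - apply/(@is_core_ofE T k) => // i; rewrite eg; have [iT|Ti] := ltnP i T; first exact: rowE.
    by rewrite !residue_lt.
have /(@is_core_ofE S k) csE := csl; have /(@is_core_ofE T k) ctE := ctl.
pose x : mx := (\matrix_(i < T, j < S) joint_count i j (beads k lam))%R.
have xm : x \in margin_mxs T S b c.
  rewrite mem_margin_mxs; apply/marginsP; split=> [i|j].
    rewrite /b -ctE // /residue_count -(sum_count_modn s).
    by apply: eq_bigr => j _; rewrite mxE.
  rewrite /c -csE // /residue_count -(sum_count_modn t).
  by apply: eq_bigr => i _; rewrite mxE; apply: eq_count => y; rewrite andbC.
have [pg sg eg] := beadsE x xm.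
apply/mapP; exists x => //; apply: (beads_inj pl pg sl sg) => y.
rewrite eg mem_flush_beads; last by move=> i j; apply: entry.
move: cl; rewrite mulnC => /(tcore_flush TS0 pl sl) fl.
rewrite (mem_flush y TS0 (beads_uniq k pl) fl) joint_count_residue.
by rewrite /at_residues mxE !inordK ?ltn_mod.
Qed.

End CoreCount.

(** * The theorem *)

(** The bead number [k0] is congruent to [i] and large enough for both cores. At
    [i + n * (s.+1 * t.+1)] beads the margins are those at [k0] scaled by [n - M], hence the
    translation of [P] by [M]. *)
Lemma core_count_eventually_poly (s t : nat) (sigma tau : seq nat) (H : {poly rat}) :
    coprime t.+1 s.+1 ->
    is_partition sigma -> is_tcore s.+1 sigma -> is_partition tau -> is_tcore t.+1 tau ->
    (forall b c : nat -> nat, \sum_(i < t.+1) b i = \sum_(j < s.+1) c j ->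
      exists P : {poly rat}, [/\ size P = (t * s).+1, (lead_coef P = lead_coef H)%R &
        exists N, forall n, N <= n -> ((transport_count t.+1 s.+1 b c n)%:R = P.[n%:R])%R]) ->
  forall i, exists P : {poly rat} * nat, [/\ size P.1 = (t * s).+1, (lead_coef P.1 = lead_coef
    H)%R &
    forall n, P.2 <= n -> exists l : seq (seq nat), [/\ uniq l,
      forall lam, lam \in l <-> [/\ is_partition lam, is_tcore (s.+1 * t.+1) lam,
        is_core_of s.+1 lam sigma, is_core_of t.+1 lam tau
        & plength lam <= i + n * (s.+1 * t.+1)] &
      ((size l)%:R = P.1.[n%:R])%R]].
Proof.
move=> co psig csig ptau ctau HP i.
pose M := maxn (size sigma) (size tau); pose k0 := i + M * (s.+1 * t.+1).
have Mk0 : M <= k0 by rewrite /k0; nia.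
have ss0 : size sigma <= k0 by apply: leq_trans Mk0; apply: leq_maxl.
have st0 : size tau <= k0 by apply: leq_trans Mk0; apply: leq_maxr.
have [|P [szP lP [N PN]]] := HP (fun i => residue_count t.+1 i (beads k0 tau))
  (fun j => residue_count s.+1 j (beads k0 sigma)).
  by rewrite !sum_residue_count !size_mkseq.
exists ((P \Po ('X + (- M%:R)%:P))%R, N + M); split=> /=.
- by have := @size_comp_linear P 1%R (- M%:R)%R (oner_neq0 _); rewrite scale1r => ->.
- by rewrite lead_coef_comp_shift.
move=> n Nn; have Mn : M <= n by apply: leq_trans Nn; apply: leq_addl.
pose k := i + n * (s.+1 * t.+1).
have kE : k = k0 + (n - M) * (s.+1 * t.+1) by rewrite /k /k0 -addnA -mulnDl subnKC.
have k0k : k0 <= k by rewrite kE leq_addr.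
have [l [ul lP' szl]] := core_count_transport co psig csig (leq_trans ss0 k0k) ptau ctau
  (leq_trans st0 k0k).
exists l; split=> //; rewrite szl horner_comp hornerD hornerX hornerC -natrB // -PN; last first.
  by rewrite leq_subRL // addnC.
congr (_%:R)%R; apply/perm_size/uniq_perm; try exact: margin_mxs_uniq.
have rowE (i' : 'I_t.+1) : residue_count t.+1 i' (beads k tau) =
    residue_count t.+1 i' (beads k0 tau) + (n - M) * s.+1.
  by rewrite kE mulnA residue_count_shift.
have colE (j' : 'I_s.+1) : residue_count s.+1 j' (beads k sigma) =
    residue_count s.+1 j' (beads k0 sigma) + (n - M) * t.+1.
  by rewrite kE [s.+1 * _]mulnC mulnA residue_count_shift.
move=> x; rewrite !mem_margin_mxs; apply/marginsP/marginsP => -[r c]; split=> [i'|j'].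
- by rewrite r rowE.
- by rewrite c colE.
- by rewrite r rowE.
- by rewrite c colE.
Qed.

Theorem theorem1 (s t : nat) (sigma tau : seq nat) :
  0 < s -> 0 < t -> coprime s t ->
  is_partition sigma -> is_tcore s sigma ->
  is_partition tau -> is_tcore t tau ->
  exists (Q : nat -> rat) (c : rat),
    quasipoly_period_deg_lead Q (s * t) ((s - 1) * (t - 1)) c /\
    (exists K : nat, forall k : nat, K <= k ->
       exists l : seq (seq nat),
         uniq l /\
         (forall lam : seq nat, lam \in l <->
            [/\ is_partition lam, is_tcore (s * t) lam,
                is_core_of s lam sigma, is_core_of t lam tau
              & plength lam <= k]) /\
         ((size l)%:R = Q k)%R) /\
    (0 < c)%R /\
    (forall R : realType, relative_volume_is (transport_polytope R s t) (ratr c)).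
Proof.
case: s t => [|s] [|t] // _ _ co psig csig ptau ctau.
have [H [szH lH [N HN] HP]] := transport_count_poly t s.
rewrite coprime_sym in co.
have /choice[F FP] := core_count_eventually_poly co psig csig ptau ctau HP.
pose p := s.+1 * t.+1.
have p0 : 0 < p by rewrite muln_gt0.
(* The residue of k modulo st selects the polynomial, which is evaluated at the quotient. *)
exists (fun k : nat => (F (k %% p)%N).1.[(k %/ p)%N%:R])%R, (lead_coef H); split; [|split;
  [|split]] => //.
- exists (fun i => (F i).1) => i ip; split; first by move=> n;
    rewrite addnC modnMDl modn_small // divnMDl // divn_small // addn0.
  by have [-> -> _] := FP i; rewrite !subn1 /= mulnC.
(* Beyond this bound the quotient of [k] by [p] exceeds the thresholds of all residue classes. *)
- exists ((\max_(i < p) (F i).2) * p) => k Kk.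
  have [_ _ Fk] := FP (k %% p).
  have [|l [ul lP szl]] := Fk (k %/ p).
    apply: (@leq_trans (\max_(i < p) (F i).2)); last by rewrite leq_divRL.
    exact: (leq_bigmax (F := fun i : 'I_p => (F i).2) (Ordinal (ltn_pmod k p0))).
  exists l; split=> //; split=> // lam; rewrite lP.
  by rewrite addnC -divn_eq.
- by move=> R; apply: relative_volume_transport szH HN.
Qed.
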